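(* Let $\tau$ be a random time such that (A) holds (under $\mathbf P$) and such that $\mathbb F$ is immersed in $\mathbb G$ under $\mathbf P$. Let $\mathbf Q$ be a probability measure which is equivalent to $\mathbf P$, and let $(e_t)$, $(E_t)$ denote the càdlàg density processes $e_t=\frac{d\mathbf Q}{d\mathbf P}\big|_{\mathcal F_t}$ and $E_t=\frac{d\mathbf Q}{d\mathbf P}\big|_{\mathcal G_t}$, with terminal values $e_\infty=\frac{d\mathbf Q}{d\mathbf P}\big|_{\mathcal F_\infty}$ and $E_\infty=\frac{d\mathbf Q}{d\mathbf P}\big|_{\mathcal G_\infty}$. (i) Assume that $d\mathbf Q/d\mathbf P=FH$ on $\mathcal G_\infty$, where $F$ is a positive $\mathcal F_\infty$-measurable integrable random variable with $\mathbb E^{\mathbf P}[F]=1$, and $H$ is a positive $\mathcal F_\tau$-measurable integrable random variable such that $\mathbb E^{\mathbf P}[H\mid\mathcal F_\infty]=1$ (and such that $FH$ is integrable). Then $\mathbb F$ is immersed in $\mathbb G$ under $\mathbf Q$. (ii) Conversely, assume that $\mathbb F$ is immersed in $\mathbb G$ under $\mathbf Q$, and assume further that $\mathbb E^{\mathbf P}\left[\frac{e_\infty^2}{E_\infty}\right]<\infty$. Then there exist random variables $F$ and $H$ such that $F$ is positive, $\mathcal F_\infty$-measurable and integrable with $\mathbb E^{\mathbf P}[F]=1$, $H$ is positive, $\mathcal F_\tau$-measurable and integrable with $\mathbb E^{\mathbf P}[H\mid\mathcal F_\infty]=1$, $FH$ is integrable, and $d\mathbf Q/d\mathbf P=FH$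 on $\mathcal G_\infty$.
   Context: $(\Omega,\mathcal G,\mathbb F=(\mathcal F_t)_{t\ge0},\mathbf P)$ is a filtered probability space satisfying the usual assumptions, with $\mathcal F_\infty=\bigvee_{t\ge0}\mathcal F_t\subset\mathcal G$. A random time is a $\mathcal G$-measurable random variable $\tau:\Omega\to[0,\infty]$. The progressively enlarged filtration $\mathbb G=(\mathcal G_t)_{t\ge0}$ is the smallest filtration satisfying the usual assumptions, containing $\mathbb F$ and making $\tau$ a stopping time: $\mathcal G_t=\bigcap_{s>t}(\mathcal F_s\vee\sigma(\tau\wedge s))$; $\mathcal G_\infty=\bigvee_t\mathcal G_t$. ''$\mathbb F$ is immersed in $\mathbb G$ under $\mathbf Q$'' means: every $(\mathbb F,\mathbf Q)$-martingale is a $(\mathbb G,\mathbf Q)$-martingale. Assumption (A): $\tau$ avoids $\mathbb F$-stopping times, i.e. $\mathbf P[\tau=T]=0$ for every $\mathbb F$-stopping time $T$ (stopping times take values in $[0,\infty]$). $\mathcal F_\tau$ is the $\sigma$-algebra generated by the random variables $z_\tau$, where $z$ ranges over all $\mathbb F$-optional processes (under (A) this agrees, up to null sets, with the one generated by $z_\tau$ for $\mathbb F$-predictable $z$). *)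

(* Defs.v *)
From HB Require Import structures.
From mathcomp Require Import all_boot all_order all_algebra.
From mathcomp Require Import all_classical all_reals all_analysis measurable_realfun.

Set Implicit Arguments.
Unset Strict Implicit.
Unset Printing Implicit Defensive.

Import Order.TTheory GRing.Theory Num.Theory.
Import numFieldNormedType.Exports.

Local Open Scope classical_set_scope.
Local Open Scope ring_scope.

(* Sub-sigma-algebras of the ambient measurable type T are families of sets
   [S : set (set T)].  The time set [0, +oo[ is represented by R: filtrations
   and processes are functions on R of which only the values at t >= 0 are
   ever constrained or used. *)

Section random_variables.
Context {d : measure_display} {T : measurableType d} {R : realType}.
Implicit Types (P Q : probability T R) (S : set (set T)) (X Y Z : T -> R).

(* sigma(X) `<=` S *)
Definition measurable_wrt S X :=
  preimage_set_system setT X measurable `<=` S.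

Definition integrable_rv P X := P.-integrable setT (EFin \o X).

(* random variables are identified when they are almost surely equal *)
Definition positive_rv P X := {ae P, forall w, 0 < X w}.

(* Y is a version of E^P[X | S]; meant for X integrable *)
Definition is_cond_exp P S X Y :=
  [/\ measurable_wrt S Y, integrable_rv P Y &
      forall A, S A ->
        (\int[P]_(w in A) (Y w)%:E = \int[P]_(w in A) (X w)%:E)%E].

(* Z is a version of (dQ/dP)|_S *)
Definition is_density P Q S Z :=
  [/\ measurable_wrt S Z, integrable_rv P Z &
      forall A, S A -> (Q A = \int[P]_(w in A) (Z w)%:E)%E].

Definition equivalent_prob P Q := P `<< Q /\ Q `<< P.

End random_variables.

Section filtrations.
Context {d : measure_display} {T : measurableType d} {R : realType}.
Implicit Types (P Q : probability T R) (Ft Gt : R -> set (set T)).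
Implicit Types (X : R -> T -> R) (tau : T -> \bar R).

Definition filtration Ft :=
  [/\ forall t : R, 0 <= t -> sigma_algebra setT (Ft t),
      forall t : R, 0 <= t -> Ft t `<=` measurable &
      forall s t : R, 0 <= s -> s <= t -> Ft s `<=` Ft t].

(* Together with [Ft 0 `<=` measurable], the last clause also makes the
   ambient probability space complete. *)
Definition usual_conditions P Ft :=
  [/\ filtration Ft,
      forall t : R, 0 <= t -> Ft t = \bigcap_(s in [set s : R | t < s]) Ft s &
      P.-negligible `<=` Ft 0].

Definition sigma_infty Ft : set (set T) :=
  <<s \bigcup_(t in [set t : R | 0 <= t]) Ft t >>.

Definition adapted Ft X := forall t : R, 0 <= t -> measurable_wrt (Ft t) (X t).

Definition cadlag X := forall w,
  (forall t : R, 0 <= t -> X s w @[s --> t^'+] --> X t w) /\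
  (forall t : R, 0 < t -> cvg (X s w @[s --> t^'-])).

Definition martingale P Ft X :=
  [/\ adapted Ft X,
      forall t : R, 0 <= t -> integrable_rv P (X t) &
      forall s t : R, 0 <= s -> s <= t -> is_cond_exp P (Ft s) (X t) (X s)].

Definition immersed P Ft Gt := forall X, martingale P Ft X -> martingale P Gt X.

Definition cadlag_density_process P Q Ft X :=
  cadlag X /\ (forall t : R, 0 <= t -> is_density P Q (Ft t) (X t)).

Definition random_time tau :=
  measurable_fun setT tau /\ (forall w, (0 <= tau w)%E).

Definition stopping_time Ft tau :=
  (forall w, (0 <= tau w)%E) /\
  (forall t : R, 0 <= t -> Ft t [set w | (tau w <= t%:E)%E]).

Definition avoids_stopping_times P Ft tau :=
  forall S, stopping_time Ft S -> P [set w | tau w = S w] = 0%E.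

(* G_t is the intersection over s > t of F_s \/ sigma(tau /\ s) *)
Definition progressive_enlargement Ft tau : R -> set (set T) := fun t =>
  \bigcap_(s in [set s : R | t < s])
    <<s Ft s `|`
        preimage_set_system setT (fun w => mine (tau w) s%:E) measurable >>.

Definition half_line : set (R * T) := [set p | 0 <= p.1].

(* sigma-algebra on [0, +oo[ x T generated by the adapted cadlag processes *)
Definition optional_sigma Ft : set (set (R * T)) :=
  <<s half_line,
      \bigcup_(X in [set X | adapted Ft X /\ cadlag X])
        preimage_set_system half_line (fun p => X p.1 p.2) measurable >>.

Definition optional Ft (z : R -> T -> R) :=
  preimage_set_system half_line (fun p => z p.1 p.2) measurable
    `<=` optional_sigma Ft.

(* z_tau for the process z indexed by [0, +oo] whose value at +oo is zoo *)
Definition value_at (z : R -> T -> R) (zoo : T -> R) tau : T -> R :=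
  fun w => if tau w is t%:E then z t w else zoo w.

(* F_tau.  An optional process indexed by [0, +oo] is an optional process on
   [0, +oo[ completed at time +oo by any F_oo-measurable variable; when tau
   avoids the stopping time +oo, the event tau = +oo is null and the choice of
   convention there is immaterial. *)
Definition sigma_at Ft tau : set (set T) :=
  <<s [set A | exists (z : R -> T -> R) (zoo : T -> R),
        [/\ optional Ft z, measurable_wrt (sigma_infty Ft) zoo &
            preimage_set_system setT (value_at z zoo tau) measurable A]] >>.

End filtrations.

(* Main.v *)
(** (i) By immersion, conditioning a G_t-measurable variable on F_oo or on F_t
    gives the same result.  If B is in G_t, then H 1_B is G_t-measurable on
    {tau <= t}, while B agrees on {tau > t} with an event of F_t; with the
    normalisation E[H | F_oo] = 1 this makes E[H 1_B | F_oo] F_t-measurable.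
    Since F is the density of Q on F_oo, this is immersion under Q.

    (ii) Take F = e_oo, h = E_oo / e_oo and H = E[h | F_tau].  Both h and H are
    such that E[h 1_C | F_oo] is F_t-measurable for every C in G_t contained in
    {tau <= t}: for h this is immersion under Q, for H immersion under P.  For
    an event B of F_oo put a_t = P[B | F_t].  On a grid (t_k), the mass that h
    or H gives to B and {t_k < tau <= t_(k+1)} is therefore that of
    a_(t_(k+1)) 1_{t_k < tau <= t_(k+1)}.  Replacing a_(t_(k+1)) by a_(t_k)
    gives an F_tau-measurable variable, on which h and H agree.  The error is
    controlled by E[sum_k |Delta a_k| Delta A_k] where A_t = P[tau <= t | F_t];
    as E[sum_k (Delta a_k)^2] <= 1, it suffices that E[sum_k (Delta A_k)^2]
    vanishes with the mesh.  Otherwise A would have jumps; the limit S of the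
    first grid times where A increases by at least eps is a stopping time by
    right-continuity of the filtration, and P[tau = S] > 0 contradicts (A).
    Hence h and H agree on F_oo v sigma(tau) = G_oo. *)
Require Import Defs.
From HB Require Import structures.
From mathcomp Require Import all_boot all_order all_algebra.
From mathcomp Require Import all_classical all_reals all_analysis measurable_realfun.
From mathcomp Require Import ring lra.
Import Order.TTheory GRing.Theory Num.Theory.
Import numFieldNormedType.Exports.
Local Open Scope classical_set_scope.
Local Open Scope ring_scope.

Set Implicit Arguments.
Unset Strict Implicit.
Unset Printing Implicit Defensive.

(** * Sub-sigma-algebras and densities *)

(** In (ii) the obstacle is that G_oo is larger than F_tau: it contains events of F_oo decided after
    tau, on which the definition of H says nothing. Immersion lets such an event B act only through
    its prediction a at the end of the grid cell containing tau, whereas F_tau knows the prediction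
    at its beginning. The martingale a may jump, so its increments need not be small; what avoidance
    gives is that tau does not charge the jumps. Since |Delta a| is F_oo-measurable, weighing it by
    the indicator of a cell amounts to weighing it by Delta A, and 2xy <= lam x^2 + y^2 / lam
    separates the two sums of squares. The weight h + H is only integrable, and is truncated. Only
    values of a and A on dyadic grids are used, so neither process has to be regularised in time.
    Conditional expectations are handled through integrals of nonnegative functions over events;
    densities, positive only almost surely, are replaced by their positive parts. *)

Definition sub_sigma d (T : measurableType d) (S : set (set T)) :=
  sigma_algebra setT S /\ S `<=` measurable.

Section density_on.
Context d (T : measurableType d) (R : realType) (mu : {measure set T -> \bar R}).
Variables (S : set (set T)) (Z : T -> R).
Hypotheses (subS : sub_sigma S) (mZ : measurable_fun setT Z)
  (Z0 : forall w, 0 <= Z w).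
Local Notation TS := (g_sigma_algebraType S).
Local Open Scope ereal_scope.

Lemma measurable_gE (A : set TS) : measurable A = S A.
Proof. by rewrite [measurable]measurable_g_measurableTypeE //; case: subS. Qed.

(** The measure with density Z, restricted to S. The proofs are arguments so that the measure
    structure can be attached to the term itself. *)
Definition density_on of sub_sigma S & measurable_fun setT Z &
  (forall w, (0 <= Z w)%R) := fun A : set TS => \int[mu]_(w in (A : set T)) (Z w)%:E.
Local Notation nu := (density_on subS mZ Z0).

Let nu0 : nu set0 = 0. Proof. by rewrite /density_on integral_set0. Qed.

Let nu_ge0 A : 0 <= nu A.
Proof. by apply: integral_ge0 => w _; rewrite lee_fin. Qed.

Let snu : semi_sigma_additive nu.
Proof.
move=> F mF tF mUF; rewrite /density_on.
have mF' i : d.-measurable (F i).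
  by have := mF i; rewrite measurable_gE; apply: subS.2.
rewrite ge0_integral_bigcup//; last 2 first.
- by apply: measurable_funTS; exact/measurable_EFinP.
- by move=> w _; rewrite lee_fin.
apply: is_cvg_ereal_nneg_natsum_cond => n _ _.
by apply: integral_ge0 => w _; rewrite lee_fin.
Qed.

HB.instance Definition _ := isMeasure.Build _ _ _ nu nu0 nu_ge0 snu.

Import HBNNSimple.

Lemma measurable_fun_sub d' (U : measurableType d') (f : TS -> U) :
  measurable_fun setT f -> measurable_fun setT (f : T -> U).
Proof.
move=> mf _ B mB; apply: subS.2; rewrite -measurable_gE.
exact: mf.
Qed.

(** The simple functions approximating f are taken on S, where [nu] lives; their products with Z are
    integrated on the ambient sigma-algebra. Monotone convergence and linearity on each side reduce
    the claim to indicators of events of S. *)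
Lemma integral_density_on (f : TS -> \bar R) : (forall x, 0 <= f x) ->
  measurable_fun setT f ->
  \int[nu]_x f x = \int[mu]_x (f x * (Z x)%:E).
Proof.
move=> f0 mf; pose h := nnsfun_approx measurableT mf.
have mh n : measurable_fun setT (h n : T -> R).
  by apply: measurable_fun_sub.
have -> : \int[nu]_x f x = lim (\int[nu]_x (EFin \o h n) x @[n --> \oo]).
  have fE x : f x = lim ((EFin \o h n) x @[n --> \oo]).
    by apply/esym/cvg_lim => //; exact: cvg_nnsfun_approx.
  under eq_integral => x _ do rewrite fE.
  apply: monotone_convergence => //.
  - by move=> n; apply/measurable_EFinP.
  - by move=> n x Ex //=; rewrite lee_fin.
  - by move=> x Ex a b ab; rewrite lee_fin; exact/lefP/nd_nnsfun_approx.
have -> : \int[mu]_x (f x * (Z x)%:E) =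
    lim (\int[mu]_x ((h n x)%:E * (Z x)%:E) @[n --> \oo]).
  have fg x : f x * (Z x)%:E = lim ((fun n => (h n x)%:E * (Z x)%:E) @ \oo).
    by apply/esym/cvg_lim => //; apply: cvgeZr => //; exact: cvg_nnsfun_approx.
  under eq_integral => x _ do rewrite fg.
  apply: monotone_convergence => [//| | |].
  - by move=> n; apply/emeasurable_funM; apply/measurable_EFinP.
  - by move=> n x Ex /=; rewrite mule_ge0 ?lee_fin.
  - move=> x Ex a b ab/=; rewrite lee_wpmul2r ?lee_fin//.
    by have /lefP := nd_nnsfun_approx measurableT mf ab; apply.
congr (lim (_ @ \oo)); apply/funext => n.
have mhr r : measurable (h n @^-1` [set r]) by exact: measurable_sfunP.
have mhr' r : d.-measurable (h n @^-1` [set r]).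
  by apply: subS.2; rewrite -measurable_gE.
transitivity (\int[nu]_x
   (\sum_(y \in range (h n)) (y * \1_(h n @^-1` [set y]) x)%:E)).
  by apply: eq_integral => t tE; rewrite /= fimfunE -fsumEFin.
rewrite ge0_integral_fsum//; last first.
- by move=> m y Ey; exact: nnfun_muleindic_ge0.
- by move=> r; apply/measurable_EFinP; exact: measurable_funM.
transitivity (\int[mu]_x (\sum_(y \in range (h n))
    (y * \1_(h n @^-1` [set y]) x)%:E * (Z x)%:E)); last first.
  apply: eq_integral => x _.
  rewrite -ge0_mule_fsuml; last by move=> y; exact: nnfun_muleindic_ge0.
  by rewrite fsumEFin // (fimfunE (h n)).
rewrite ge0_integral_fsum//; last 2 first.
  - move=> y; apply: emeasurable_funM; last exact/measurable_EFinP.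
    by apply/measurable_EFinP; exact: measurable_funM.
  - move=> m y Ey; rewrite mule_ge0 ?lee_fin//.
    by rewrite -lee_fin EFinM nnfun_muleindic_ge0.
apply: eq_fsbigr => r /[!inE] -[t _ hr].
have r0 : (0 <= r)%R by rewrite -hr.
under eq_integral do rewrite EFinM.
rewrite ge0_integralZl//; last first.
- by apply/measurable_EFinP.
rewrite integral_indic// setIT.
have -> : \int[mu]_x ((r * \1_(h n @^-1` [set r]) x)%:E * (Z x)%:E) =
    \int[mu]_x (r%:E * ((\1_(h n @^-1` [set r]) x)%:E * (Z x)%:E)).
  by apply: eq_integral => x _; rewrite EFinM muleA.
rewrite [RHS]ge0_integralZl//.
- congr (_ * _); rewrite /= /density_on integral_mkcond.
  by apply: eq_integral => x _; rewrite epatch_indic muleC.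
- by apply: emeasurable_funM; apply/measurable_EFinP.
- by move=> x _; rewrite mule_ge0 ?lee_fin.
Qed.

End density_on.

Section sub_sigma_theory.
Context d (T : measurableType d) (R : realType).
Implicit Types (S : set (set T)) (A B : set T) (X Y Z : T -> R).
Local Notation TS S := (g_sigma_algebraType S).

Lemma sub_sigmaC S A : sub_sigma S -> S A -> S (~` A).
Proof. by move=> sS; rewrite -!(measurable_gE sS); exact: measurableC. Qed.

Lemma sub_sigmaT S : sub_sigma S -> S setT.
Proof. by move=> sS; rewrite -(measurable_gE sS); exact: measurableT. Qed.

Lemma sub_sigma0 S : sub_sigma S -> S set0.
Proof. by move=> sS; rewrite -(measurable_gE sS); exact: measurable0. Qed.

Lemma sub_sigmaI S A B : sub_sigma S -> S A -> S B -> S (A `&` B).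
Proof. by move=> sS; rewrite -!(measurable_gE sS); exact: measurableI. Qed.

Lemma sub_sigmaU S A B : sub_sigma S -> S A -> S B -> S (A `|` B).
Proof. by move=> sS; rewrite -!(measurable_gE sS); exact: measurableU. Qed.

Lemma sub_sigmaD S A B : sub_sigma S -> S A -> S B -> S (A `\` B).
Proof. by move=> sS; rewrite -!(measurable_gE sS); exact: measurableD. Qed.

Lemma sub_sigma_bigcup S (F : (set T)^nat) : sub_sigma S ->
  (forall i, S (F i)) -> S (\bigcup_i F i).
Proof.
move=> sS SF; rewrite -(measurable_gE sS); apply: bigcup_measurable => i _.
by rewrite (measurable_gE sS).
Qed.

Lemma sub_sigma_bigcap S (F : (set T)^nat) : sub_sigma S ->
  (forall i, S (F i)) -> S (\bigcap_i F i).
Proof.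
move=> sS SF; rewrite -(measurable_gE sS); apply: bigcapT_measurable => i.
by rewrite (measurable_gE sS).
Qed.

Lemma sub_sigma_generated (G : set (set T)) : G `<=` measurable ->
  sub_sigma <<s G >>.
Proof.
move=> Gm; split; first exact: smallest_sigma_algebra.
by apply: smallest_sub => //; exact: sigma_algebra_measurable.
Qed.

Lemma measurable_wrtP S X : sub_sigma S ->
  measurable_wrt S X <-> measurable_fun (setT : set (TS S)) (X : TS S -> R).
Proof.
move=> sS; split.
  move=> mX _ B mB; rewrite (measurable_gE sS); apply: mX.
  by exists B.
by move=> mX _ [B mB <-]; rewrite -(measurable_gE sS); exact: mX.
Qed.

Lemma measurable_wrt_le S S' X : S `<=` S' -> measurable_wrt S X ->
  measurable_wrt S' X.
Proof. by move=> SS' mX; apply: subset_trans SS'. Qed.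

Lemma measurable_wrt_fun S X : sub_sigma S -> measurable_wrt S X ->
  measurable_fun setT X.
Proof.
move=> sS mX _ B mB; apply: sS.2; apply: mX.
by exists B.
Qed.

Lemma measurable_wrt_cst S (c : R) : sub_sigma S ->
  measurable_wrt S (cst c).
Proof. by move=> sS; apply/measurable_wrtP => //; exact: measurable_cst. Qed.

Lemma measurable_wrt_indic S A : sub_sigma S -> S A ->
  measurable_wrt S (\1_A : T -> R).
Proof.
move=> sS SA; apply/measurable_wrtP => //.
by apply: measurable_indic; rewrite (measurable_gE sS).
Qed.

Lemma measurable_wrtM S X Y : sub_sigma S -> measurable_wrt S X ->
  measurable_wrt S Y -> measurable_wrt S (fun w => X w * Y w).
Proof.
move=> sS /(measurable_wrtP _ sS) mX /(measurable_wrtP _ sS) mY.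
by apply/measurable_wrtP => //; exact: measurable_funM.
Qed.

Lemma measurable_wrtD S X Y : sub_sigma S -> measurable_wrt S X ->
  measurable_wrt S Y -> measurable_wrt S (fun w => X w + Y w).
Proof.
move=> sS /(measurable_wrtP _ sS) mX /(measurable_wrtP _ sS) mY.
by apply/measurable_wrtP => //; exact: measurable_funD.
Qed.

Lemma measurable_wrtB S X Y : sub_sigma S -> measurable_wrt S X ->
  measurable_wrt S Y -> measurable_wrt S (fun w => X w - Y w).
Proof.
move=> sS /(measurable_wrtP _ sS) mX /(measurable_wrtP _ sS) mY.
by apply/measurable_wrtP => //; exact: measurable_funB.
Qed.

Lemma measurable_wrt_comp S X (f : R -> R) : sub_sigma S ->
  measurable_fun setT f -> measurable_wrt S X -> measurable_wrt S (f \o X).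
Proof.
move=> sS mf /(measurable_wrtP _ sS) mX.
by apply/measurable_wrtP => //; exact: measurableT_comp.
Qed.

Lemma measurable_wrt_max0 S X : sub_sigma S -> measurable_wrt S X ->
  measurable_wrt S (fun w => Num.max (X w) 0).
Proof.
move=> sS mX; apply: (@measurable_wrt_comp _ _ (fun x => Num.max x 0)) mX => //.
by apply: (@measurable_maxr _ _ _ setT id (cst 0)).
Qed.

Lemma measurable_wrtV S X : sub_sigma S -> measurable_wrt S X ->
  (forall w, 0 <= X w) -> measurable_wrt S (fun w => (X w)^-1).
Proof.
move=> sS mX X0; have -> : (fun w => (X w)^-1) = (fun x => x `^ (-1)) \o X.
  by apply/funext => w /=; rewrite powR_inv1.
by apply: measurable_wrt_comp mX => //; exact: measurable_powR.
Qed.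

Lemma measurable_wrt_ge S X (c : R) : sub_sigma S ->
  measurable_wrt S X -> S [set w | c <= X w].
Proof.
move=> sS mX; apply: mX; exists [set` `[c, +oo[ ] => //.
by rewrite setTI; apply/seteqP; split => w /=; rewrite in_itv/= andbT.
Qed.

Local Open Scope ereal_scope.

Lemma integral_indicM (mu : {measure set T -> \bar R}) A Z :
  \int[mu]_(w in A) (Z w)%:E = \int[mu]_w (\1_A w * Z w)%:E.
Proof.
rewrite integral_mkcond; apply: eq_integral => w _.
by rewrite epatch_indic/= -EFinM mulrC.
Qed.

(** Both integrals are those of Y against one and the same measure on S, given by Z1 under [mu1] and
    by Z2 under [mu2]. With equal measures this is the pull-out property of conditional expectation;
    with [mu1 = Q], Z1 = 1 and [mu2 = P] it is a change of measure. *)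
Lemma take_out (mu1 mu2 : {measure set T -> \bar R}) S Z1 Z2 Y :
  sub_sigma S ->
  measurable_fun setT Z1 -> (forall w, 0 <= Z1 w)%R ->
  measurable_fun setT Z2 -> (forall w, 0 <= Z2 w)%R ->
  (forall A, S A -> \int[mu1]_(w in A) (Z1 w)%:E = \int[mu2]_(w in A) (Z2 w)%:E) ->
  measurable_wrt S Y -> (forall w, 0 <= Y w)%R ->
  \int[mu1]_w (Y w * Z1 w)%:E = \int[mu2]_w (Y w * Z2 w)%:E.
Proof.
move=> sS mZ1 Z10 mZ2 Z20 Z12 /(measurable_wrtP _ sS) mY Y0.
under eq_integral do rewrite EFinM.
rewrite -(@integral_density_on _ _ _ mu1 _ _ sS mZ1 Z10 (EFin \o Y)) //=; last first.
  exact/measurable_EFinP.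
under [RHS]eq_integral do rewrite EFinM.
rewrite -(@integral_density_on _ _ _ mu2 _ _ sS mZ2 Z20 (EFin \o Y)) //=; last first.
  exact/measurable_EFinP.
apply: eq_measure_integral => A mA _; rewrite /density_on/=; apply: Z12.
by rewrite -(measurable_gE sS).
Qed.

Lemma take_out_set (mu1 mu2 : {measure set T -> \bar R}) S Z1 Z2 Y A :
  sub_sigma S -> S A ->
  measurable_fun setT Z1 -> (forall w, 0 <= Z1 w)%R ->
  measurable_fun setT Z2 -> (forall w, 0 <= Z2 w)%R ->
  (forall A, S A -> \int[mu1]_(w in A) (Z1 w)%:E = \int[mu2]_(w in A) (Z2 w)%:E) ->
  measurable_wrt S Y -> (forall w, 0 <= Y w)%R ->
  \int[mu1]_(w in A) (Y w * Z1 w)%:E = \int[mu2]_(w in A) (Y w * Z2 w)%:E.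
Proof.
move=> sS SA mZ1 Z10 mZ2 Z20 Z12 mY Y0.
rewrite (integral_indicM mu1 A) (integral_indicM mu2 A); under eq_integral do rewrite mulrA.
rewrite (take_out sS mZ1 Z10 mZ2 Z20 Z12) //.
- by apply: eq_integral => w _; rewrite mulrA.
- by apply: measurable_wrtM => //; exact: measurable_wrt_indic.
- by move=> w; rewrite mulr_ge0.
Qed.

(** Radon-Nikodym on S, for the measure with density X against the restriction of P, which is the
    one with density 1. *)
Lemma cond_exp_exists (P : probability T R) S X : sub_sigma S ->
  measurable_fun setT X -> (forall w, 0 <= X w)%R ->
  \int[P]_w (X w)%:E < +oo ->
  exists Y, [/\ measurable_wrt S Y, (forall w, 0 <= Y w)%R &
    forall A, S A -> \int[P]_(w in A) (X w)%:E = \int[P]_(w in A) (Y w)%:E].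
Proof.
move=> sS mX X0 intX.
have m1 : measurable_fun setT (cst 1%R : T -> R) by exact: measurable_cst.
have p1 : forall w : T, (0 <= cst 1%R w :> R)%R by move=> w; rewrite /= ler01.
pose m := density_on P sS m1 p1; pose nu := density_on P sS mX X0.
have int1 (A : set T) : measurable A -> \int[P]_(w in A) (cst 1%R w : R)%:E = P A.
  by move=> mA; rewrite -[RHS]mul1e -integral_cst.
have finm : fin_num_fun m.
  move=> A mA; rewrite /m /density_on.
  have mA' : d.-measurable A by apply: sS.2; rewrite -(measurable_gE sS).
  by rewrite int1// fin_num_measure.
have finnu : fin_num_fun nu.
  move=> A mA; rewrite /nu /density_on.
  have mA' : d.-measurable A by apply: sS.2; rewrite -(measurable_gE sS).
  rewrite ge0_fin_numE; last by apply: integral_ge0 => w _; rewrite lee_fin.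
  apply: le_lt_trans intX; apply: ge0_subset_integral => //.
  - exact/measurable_EFinP.
  - by move=> w _; rewrite lee_fin.
pose m' : {finite_measure set (TS S) -> \bar R} :=
  HB.pack m (Measure_isFinite.Build _ _ _ m finm).
pose nu' : {finite_measure set (TS S) -> \bar R} :=
  HB.pack nu (Measure_isFinite.Build _ _ _ nu finnu).
have numm : nu' `<< m'.
  apply/null_content_dominatesP => A mA; rewrite /= /m /nu /density_on.
  have mA' : d.-measurable A by apply: sS.2; rewrite -(measurable_gE sS).
  rewrite int1// => PA0.
  by apply: null_set_integral => //; apply: measurable_funTS; exact/measurable_EFinP.
have [f [f0 ffin fint fE]] := radon_nikodym_sigma_finite numm.
have mf := measurable_int _ fint.
exists (fine \o f); split.
- apply/measurable_wrtP => //.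
  by apply: measurableT_comp => //; exact: fine_measurable.
- by move=> w /=; rewrite fine_ge0.
- move=> A SA; have mA : measurable (A : set (TS S)) by rewrite (measurable_gE sS).
  have := fE _ mA; rewrite /= {1}/nu /density_on => ->.
  rewrite integral_mkcond integral_density_on; last 2 first.
  + by move=> w; apply: erestrict_ge0.
  + apply/(measurable_restrictT _ _).1 => //.
    exact: measurable_funTS.
  rewrite [RHS]integral_mkcond; apply: eq_integral => w _.
  by rewrite mule1 !patchE; case: ifP => //= _; rewrite fineK.
Qed.

End sub_sigma_theory.

(** * Martingales and immersion *)

Section integral_determination.
Context d (T : measurableType d) (R : realType) (mu : {measure set T -> \bar R}).
Implicit Types (S : set (set T)) (A B : set T) (X Y Z : T -> R).
Local Open Scope ereal_scope.

Lemma fin_num_addeI (a x y : \bar R) : a \is a fin_num -> a + x = a + y -> x = y.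
Proof.
by move=> afin /(congr1 (fun z => z - a)); rewrite !(addeC a) !addeK.
Qed.

Lemma integrable_rv_ge0 (P : probability T R) X : measurable_fun setT X ->
  (forall w, 0 <= X w)%R -> \int[P]_w (X w)%:E < +oo -> integrable_rv P X.
Proof.
move=> mX X0 intX; apply/integrableP; split; first exact/measurable_EFinP.
by under eq_integral do rewrite /= ger0_norm//.
Qed.

Lemma integral_lty_subset A Z : measurable A -> measurable_fun setT Z ->
  (forall w, 0 <= Z w)%R -> \int[mu]_w (Z w)%:E < +oo ->
  \int[mu]_(w in A) (Z w)%:E < +oo.
Proof.
move=> mA mZ Z0; apply: le_lt_trans; apply: ge0_subset_integral => //.
- exact/measurable_EFinP.
- by move=> w _; rewrite lee_fin.
Qed.

Lemma integral_setC A Z : measurable A -> measurable_fun setT Z ->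
  (forall w, 0 <= Z w)%R ->
  \int[mu]_w (Z w)%:E = \int[mu]_(w in A) (Z w)%:E + \int[mu]_(w in ~` A) (Z w)%:E.
Proof.
move=> mA mZ Z0; rewrite -ge0_integral_setU ?setUv//.
- exact: measurableC.
- exact/measurable_EFinP.
- by move=> w _; rewrite lee_fin.
- by apply/disj_setPCl.
Qed.

Lemma eq_integral_generated (K : set (set T)) Z1 Z2 : K `<=` measurable ->
  setI_closed K ->
  measurable_fun setT Z1 -> (forall w, 0 <= Z1 w)%R -> \int[mu]_w (Z1 w)%:E < +oo ->
  measurable_fun setT Z2 -> (forall w, 0 <= Z2 w)%R ->
  \int[mu]_w (Z1 w)%:E = \int[mu]_w (Z2 w)%:E ->
  (forall A, K A -> \int[mu]_(w in A) (Z1 w)%:E = \int[mu]_(w in A) (Z2 w)%:E) ->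
  forall A, <<s K >> A -> \int[mu]_(w in A) (Z1 w)%:E = \int[mu]_(w in A) (Z2 w)%:E.
Proof.
move=> Km KI mZ1 Z10 iZ1 mZ2 Z20 iE KE.
have [_ sKm] := sub_sigma_generated Km.
apply: (@dynkin_induction _ (g_sigma_algebraType K) K) => //.
- move=> A /sKm mA AE.
  have := integral_setC mA mZ1 Z10.
  rewrite iE (integral_setC mA mZ2 Z20) AE.
  move/esym/fin_num_addeI; apply.
  rewrite ge0_fin_numE; first by rewrite integral_lty_subset// -iE.
  by apply: integral_ge0 => w _; rewrite lee_fin.
- move=> F mF tF FE.
  have mF' n : d.-measurable (F n) by exact: sKm (mF n).
  rewrite !ge0_integral_bigcup//.
  + by apply: eq_eseriesr => n _; exact: FE.
  + by apply: measurable_funTS; exact/measurable_EFinP.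
  + by move=> w _; rewrite lee_fin.
  + by apply: measurable_funTS; exact/measurable_EFinP.
  + by move=> w _; rewrite lee_fin.
Qed.

End integral_determination.

Section immersion.
Context d (T : measurableType d) (R : realType).
Variables (P : probability T R) (Ft Gt : R -> set (set T)).
Implicit Types (S : set (set T)) (A B : set T) (X Y Z : T -> R).
Hypotheses (filF : filtration Ft)
  (subG : forall t, 0 <= t -> sub_sigma (Gt t))
  (imm : immersed P Ft Gt).
Local Open Scope ereal_scope.

Lemma filtration_sub t : (0 <= t)%R -> sub_sigma (Ft t).
Proof. by case: filF => F1 F2 _ t0; split; [exact: F1|exact: F2]. Qed.

Lemma sigma_infty_sub : sub_sigma (sigma_infty Ft).
Proof.
apply: sub_sigma_generated => A [t t0] FtA.
by apply: (filtration_sub t0).2.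
Qed.

Lemma filtration_sigma_infty t : (0 <= t)%R -> Ft t `<=` sigma_infty Ft.
Proof. by move=> t0 A FA; apply: sub_sigma_algebra; exists t. Qed.

(** On both sides 1_A may be replaced by M_t = P[A | F_t]: for xi because immersion makes M a
    G-martingale and xi is G_t-measurable, for x because x is F_t-measurable. As M_t is itself
    F_t-measurable, the hypothesis on xi and x closes the gap. *)
Lemma filtration_cond_exp t xi x A s : (0 <= t)%R -> (t <= s)%R -> Ft s A ->
  measurable_wrt (Gt t) xi -> (forall w, 0 <= xi w)%R ->
  measurable_wrt (Ft t) x -> (forall w, 0 <= x w)%R ->
  (forall B, Ft t B -> \int[P]_(w in B) (xi w)%:E = \int[P]_(w in B) (x w)%:E) ->
  \int[P]_(w in A) (xi w)%:E = \int[P]_(w in A) (x w)%:E.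
Proof.
move=> t0 ts FsA mxi xi0 mx x0 xiE.
have s0 := le_trans t0 ts.
have [_ _ Fmono] := filF.
have mA : measurable A by exact: (filtration_sub s0).2.
have mi : measurable_fun setT (\1_A : T -> R) by exact: measurable_indic.
have i0 w : (0 <= \1_A w :> R)%R by [].
have int1 B : measurable B -> \int[P]_(w in B) (\1_A w : R)%:E < +oo.
  move=> mB; apply: integral_lty_subset => //.
  by rewrite integral_indic// setIT (le_lt_trans (probability_le1 _ _))// ltry.
(* The version M_u of P[A | F_u] is exactly 1_A from time s on, so that the martingale ends at 1_A
   without an almost sure identification; at negative times it is 0. *)
have H u : exists Y : T -> R, [/\ forall w, (0 <= Y w)%R,
    (0 <= u)%R -> measurable_wrt (Ft u) Y /\
      forall B, Ft u B -> \int[P]_(w in B) (\1_A w)%:E = \int[P]_(w in B) (Y w)%:E &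
    (s <= u)%R -> Y = \1_A].
  have [su|us] := leP s u.
    exists \1_A; split=> // u0; split=> //.
    apply: measurable_wrt_indic; first exact: filtration_sub.
    exact: Fmono FsA.
  have [u0|u0] := leP 0%R u; last by exists (cst 0%R); split.
  have [Y [mY Y0 YE]] := cond_exp_exists (filtration_sub u0) mi i0 (int1 _ measurableT).
  by exists Y; split.
have [M MP] := choice H.
have mM u : (0 <= u)%R -> measurable_fun setT (M u).
  move=> u0; have [_ /(_ u0)[mMu _] _] := MP u.
  exact: measurable_wrt_fun (filtration_sub u0) mMu.
have iM u : (0 <= u)%R -> integrable_rv P (M u).
  move=> u0; have [Mu0 /(_ u0)[_ MuE] _] := MP u.
  apply: integrable_rv_ge0 => //; first exact: mM.
  rewrite -MuE; first exact: int1.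
  exact: sub_sigmaT (filtration_sub u0).
have martM : martingale P Ft M.
  split=> //.
    by move=> u u0; have [_ /(_ u0)[]] := MP u.
  move=> u v u0 uv; have v0 := le_trans u0 uv.
  have [_ /(_ u0)[mMu MuE] _] := MP u.
  have [_ /(_ v0)[mMv MvE] _] := MP v.
  split=> //; first exact: iM.
  by move=> B FB; rewrite -MuE// -MvE//; exact: Fmono FB.
have [_ _ /(_ _ _ t0 ts)[_ _ GE]] := imm martM.
have [Mt0 /(_ t0)[mMt MtE] _] := MP t.
have [_ _ /(_ (lexx s)) MsE] := MP s.
rewrite MsE in GE.
rewrite (integral_indicM P A xi) (integral_indicM P A x).
have comm (X Y : T -> R) : \int[P]_w (X w * Y w)%:E = \int[P]_w (Y w * X w)%:E.
  by under eq_integral do rewrite mulrC.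
rewrite comm (@take_out _ _ _ P P (Gt t) (\1_A) (M t) xi)//; last 3 first.
- exact: subG.
- exact: mM.
- by move=> B GB; rewrite GE.
rewrite comm (@take_out _ _ _ P P (Ft t) xi x (M t))//; last 3 first.
- exact: filtration_sub.
- by apply: measurable_wrt_fun mxi; exact: subG.
- by apply: measurable_wrt_fun mx; exact: filtration_sub.
rewrite comm (@take_out _ _ _ P P (Ft t) (M t) (\1_A) x)//.
- exact: filtration_sub.
- exact: mM.
- by move=> B FB; rewrite MtE.
Qed.

(** The events of all the F_s form a pi-system generating F_oo. *)
Lemma immersed_cond_exp t xi x : (0 <= t)%R ->
  measurable_wrt (Gt t) xi -> (forall w, 0 <= xi w)%R ->
  \int[P]_w (xi w)%:E < +oo ->
  measurable_wrt (Ft t) x -> (forall w, 0 <= x w)%R ->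
  (forall B, Ft t B -> \int[P]_(w in B) (xi w)%:E = \int[P]_(w in B) (x w)%:E) ->
  forall A, sigma_infty Ft A -> 
    \int[P]_(w in A) (xi w)%:E = \int[P]_(w in A) (x w)%:E.
Proof.
move=> t0 mxi xi0 ixi mx x0 xiE; have [_ _ Fmono] := filF.
apply: eq_integral_generated => //.
- move=> A [s s0 FA]; exact: (filtration_sub s0).2.
- move=> A B [s s0 FA] [u u0 FB]; exists (Num.max s u).
    by rewrite /= le_max (s0 : (0 <= s)%R).
  apply: sub_sigmaI.
  + by apply: filtration_sub; rewrite le_max (s0 : (0 <= s)%R).
  + by apply: Fmono FA => //; rewrite le_max lexx.
  + by apply: Fmono FB => //; rewrite le_max lexx orbT.
- by apply: measurable_wrt_fun mxi; exact: subG.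
- by apply: measurable_wrt_fun mx; exact: filtration_sub.
- by apply: xiE; exact: sub_sigmaT (filtration_sub t0).
- move=> A [s s0 FA].
  apply: (@filtration_cond_exp t xi x A (Num.max s t)) => //.
  + by rewrite le_max lexx orbT.
  + by apply: Fmono FA => //; rewrite le_max lexx.
Qed.

End immersion.

(** * The progressively enlarged filtration *)

Lemma exists_invS_le (R : realType) (x : R) : 0 < x -> exists n, n.+1%:R^-1 <= x.
Proof.
move=> x0; exists (Num.truncn x^-1).
rewrite -[leRHS]invrK lef_pV2 ?posrE ?invr_gt0//.
have xi0 : 0 <= x^-1 by rewrite invr_ge0 ltW.
by have /andP[_ /ltW] := truncn_itv xi0.
Qed.

Section enlargement.
Context d (T : measurableType d) (R : realType).
Variables (P : probability T R) (Ft : R -> set (set T)) (tau : T -> \bar R).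
Hypotheses (usualF : usual_conditions P Ft) (rt_tau : random_time tau).
Local Notation Gt := (progressive_enlargement Ft tau).
Implicit Types (A B D : set T) (s t u : R).

Let filF : filtration Ft. Proof. by case: usualF. Qed.
Let mtau : measurable_fun setT tau. Proof. by case: rt_tau. Qed.
Let subF t : 0 <= t -> sub_sigma (Ft t). Proof. by move=> t0; apply: (filtration_sub filF). Qed.

Definition enlargement_gen s := Ft s `|`
  preimage_set_system setT (fun w => mine (tau w) s%:E) measurable.

Lemma enlargement_gen_sub s : 0 <= s -> sub_sigma <<s enlargement_gen s >>.
Proof.
move=> s0; apply: sub_sigma_generated => A [|[B mB <-]].
  exact: (subF s0).2.
have := @measurable_mine _ _ _ setT tau (cst s%:E) mtau (@measurable_cst _ _ _ _ _ _).
by apply.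
Qed.

Lemma enlargement_sub t : 0 <= t -> sub_sigma (Gt t).
Proof.
move=> t0; split.
  apply: sigma_algebra_bigcap => s /= ts.
  exact: smallest_sigma_algebra.
move=> A GA; have t1 : 0 <= t + 1 by rewrite addr_ge0.
apply: (enlargement_gen_sub t1).2; apply: GA => /=.
by rewrite ltrDl.
Qed.

Lemma filtration_enlargement t : 0 <= t -> Ft t `<=` Gt t.
Proof.
move=> t0 A FA s /= ts; apply: sub_sigma_algebra; left.
by case: filF => _ _ Fmono; apply: Fmono FA => //; exact: ltW.
Qed.

Lemma enlargement_filtration : filtration Gt.
Proof.
split=> [t t0|t t0|s t s0 st]; [exact: (enlargement_sub t0).1|
  exact: (enlargement_sub t0).2|].
by move=> A GA u /= tu; apply: GA => /=; exact: le_lt_trans tu.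
Qed.

Lemma enlargement_le t u : u <= t -> Gt t [set w | (tau w <= u%:E)%E].
Proof.
move=> ut s /= ts; apply: sub_sigma_algebra; right.
exists [set` `]-oo, u%:E]]; first exact: emeasurable_itv.
rewrite setTI; apply/seteqP; split => w /=; rewrite in_itv/= ge_min.
  by case/orP => //; rewrite lee_fin leNgt (le_lt_trans ut ts).
by move=> ->.
Qed.

Lemma enlargement_min t (B : set \bar R) : measurable B ->
  Gt t [set w | B (mine (tau w) t%:E)].
Proof.
move=> mB s /= ts; apply: sub_sigma_algebra; right.
exists [set x | B (mine x t%:E)].
  have := @measurable_mine _ _ R setT id (cst t%:E) (@measurable_id _ _ _)
    (@measurable_cst _ _ _ _ _ _) measurableT _ mB.
  by rewrite setTI.
have ts' : (t%:E <= s%:E)%E by rewrite lee_fin ltW.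
by rewrite setTI; apply/seteqP; split => w /=; rewrite -minA (min_idPr ts').
Qed.

(** On {s <= tau} the variable min(tau, s) is constant, so every event of F_s v sigma(min(tau, s))
    has there the trace of an event of F_s. Right-continuity of F then lets s decrease to t. *)
Lemma enlargement_trace_gt t B : 0 <= t -> Gt t B ->
  exists2 C, Ft t C & B `&` [set w | (t%:E < tau w)%E] =
                      C `&` [set w | (t%:E < tau w)%E].
Proof.
move=> t0 GB; have [_ Frc _] := usualF; have [_ _ Fmono] := filF.
have H s : t < s -> exists2 C, Ft s C & B `&` [set w | (s%:E <= tau w)%E] =
                      C `&` [set w | (s%:E <= tau w)%E].
  move=> ts; have s0 : 0 <= s by exact/ltW/(le_lt_trans t0 ts).
  have := GB _ ts.
  pose K := [set B | exists2 C, Ft s C & B `&` [set w | (s%:E <= tau w)%E] =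
                      C `&` [set w | (s%:E <= tau w)%E]].
  suff : <<s enlargement_gen s >> `<=` K by apply.
  apply: smallest_sub.
    split.
    - by exists set0 => //; exact: sub_sigma0 (subF s0).
    - move=> A [C FC AC]; exists (~` C); first exact: sub_sigmaC (subF s0) FC.
      rewrite setTD; apply/seteqP; split => w /= [Aw sw]; split => // Cw; apply: Aw.
        by have [] : (A `&` [set w | (s%:E <= tau w)%E]) w by rewrite AC.
      by have [] : (C `&` [set w | (s%:E <= tau w)%E]) w by rewrite -AC.
    - move=> A /(_ _)/cid2-/all_sig2[C FC AC]; exists (\bigcup_i C i).
        exact: sub_sigma_bigcup (subF s0) FC.
      by rewrite !setI_bigcupl; apply: eq_bigcupr => i _; exact: AC.
  move=> A [FA|[V mV <-]]; first by exists A.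
  have [Vs|Vs] := pselect (V s%:E).
    exists setT; first exact: sub_sigmaT (subF s0).
    apply/seteqP; split => w /= [] // _ sw; split => //; split => //.
    by rewrite (min_idPr sw).
  exists set0; first exact: sub_sigma0 (subF s0).
  rewrite set0I setTI -subset0 => w /= [Vw sw]; apply: Vs.
  by rewrite (min_idPr sw) in Vw.
have tn n : t < t + n.+1%:R^-1 by rewrite ltrDl invr_gt0.
have /all_sig2[C FC BC] : forall n, {C | Ft (t + n.+1%:R^-1) C &
    B `&` [set w | ((t + n.+1%:R^-1)%:E <= tau w)%E] =
    C `&` [set w | ((t + n.+1%:R^-1)%:E <= tau w)%E]}.
  by move=> n; apply: cid2; exact: H.
(* The lower limit of the C_n: it does not depend on finitely many of them, hence lies in F_s for
   every s > t, and wherever t < tau all C_n with n large agree with B. *)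
exists (\bigcup_m \bigcap_n C (m + n)%N).
  rewrite Frc// => s /= ts.
  have s0 : 0 <= s by exact/ltW/(le_lt_trans t0 ts).
  have [N tNs] : exists N, t + N.+1%:R^-1 <= s.
    have [N tN] : exists n, n.+1%:R^-1 <= s - t by apply: exists_invS_le; rewrite subr_gt0.
    by exists N; rewrite -lerBrDl.
  have -> : \bigcup_m \bigcap_n C (m + n)%N = \bigcup_m \bigcap_n C ((N + m) + n)%N.
    apply/seteqP; split => w [m _ Cm].
      by exists m => // n _; rewrite -addnA addnCA; exact: Cm.
    by exists (N + m)%N.
  apply: sub_sigma_bigcup (subF s0) _ => m.
  apply: sub_sigma_bigcap (subF s0) _ => n.
  apply: Fmono (FC _); first by rewrite addr_ge0 ?invr_ge0.
  apply: le_trans tNs; rewrite lerD2l lef_pV2 ?posrE// ler_nat -addnA ltnS.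
  exact: leq_addr.
have tau_gt w : (t%:E < tau w)%E -> exists m, ((t + m.+1%:R^-1)%:E <= tau w)%E.
  case: (tau w) => [r| |] //=; last by move=> _; exists 0%N; rewrite leey.
  rewrite lte_fin => tr.
  have [m tm] : exists n, n.+1%:R^-1 <= r - t by apply: exists_invS_le; rewrite subr_gt0.
  by exists m; rewrite lee_fin -lerBrDl.
apply/seteqP; split => w /= [BCw tw]; split => //.
  have [m tm] := tau_gt w tw.
  exists m => // n _.
  suff [] : (C (m + n)%N `&` [set w | ((t + (m + n).+1%:R^-1)%:E <= tau w)%E]) w by [].
  rewrite -BC; split => //=; apply: le_trans tm; rewrite lee_fin lerD2l.
  by rewrite lef_pV2 ?posrE// ler_nat ltnS leq_addr.
case: BCw => m _ Cw.
have [k tk] := tau_gt w tw.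
suff [] : (B `&` [set w | ((t + (m + k).+1%:R^-1)%:E <= tau w)%E]) w by [].
rewrite BC; split; first exact: Cw.
apply: le_trans tk; rewrite lee_fin lerD2l.
by rewrite lef_pV2 ?posrE// ler_nat ltnS leq_addl.
Qed.

End enlargement.

(** * Events of F_tau on {tau <= t} *)

Section sigma_at.
Context d (T : measurableType d) (R : realType).
Variables (P : probability T R) (Ft : R -> set (set T)) (tau : T -> \bar R).
Hypotheses (usualF : usual_conditions P Ft) (rt_tau : random_time tau).
Local Notation Gt := (progressive_enlargement Ft tau).
Implicit Types (A B D : set T) (s t u : R) (X : R -> T -> R).

Let filF : filtration Ft. Proof. by case: usualF. Qed.
Let tau0 w : (0 <= tau w)%E. Proof. by case: rt_tau. Qed.
Let subG t : 0 <= t -> sub_sigma (Gt t).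
Proof. by move=> t0; apply: (enlargement_sub usualF rt_tau). Qed.

(** The approximation is strictly from the right, as right limits demand, and the cap at t keeps the
    sampled values F_t-measurable; u < t leaves room for both. *)
Lemma cvg_grid_right t u : 0 <= u < t ->
  (forall n, u < Num.min t ((Num.truncn (u * n.+1%:R)).+1%:R / n.+1%:R)) /\
  Num.min t ((Num.truncn (u * n.+1%:R)).+1%:R / n.+1%:R) @[n --> \oo] --> u.
Proof.
move=> /andP[u0 ut].
have H n : u < (Num.truncn (u * n.+1%:R)).+1%:R / n.+1%:R <= u + n.+1%:R^-1.
  have un0 : 0 <= u * n.+1%:R by rewrite mulr_ge0.
  have /andP[H1 H2] := truncn_itv un0.
  rewrite ltr_pdivlMr// H2/= ler_pdivrMr// mulrDl mulVf ?pnatr_eq0//.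
  by rewrite -natr1 lerD2r.
have Hn n : u < Num.min t ((Num.truncn (u * n.+1%:R)).+1%:R / n.+1%:R).
  by rewrite lt_min ut/=; case/andP: (H n).
split=> //.
apply: (@squeeze_cvgr _ _ _ _ (cst u) (fun n => u + n.+1%:R^-1)).
- apply: nearW => n /=; rewrite (ltW (Hn n))/= ge_min.
  by case/andP: (H n) => _ ->; rewrite orbT.
- exact: cvg_cst.
- rewrite -[X in _ --> X]addr0; apply: cvgD; first exact: cvg_cst.
  exact: cvg_harmonic.
Qed.

(** X at tau is the limit of X at the next grid time after tau, and each such sample coincides with
    X at a fixed grid time on an event of G_t that locates tau in a grid cell. *)
Lemma cadlag_sample X t : 0 <= t -> adapted Ft X -> cadlag X ->
  measurable_wrt (Gt t)
    (fun w => if (tau w <= t%:E)%E then X (fine (tau w)) w else 0).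
Proof.
move=> t0 adX cX.
pose grid n k : R := Num.min t (k.+1%:R / n.+1%:R).
pose Y n w := if (tau w <= t%:E)%E then
  X (grid n (Num.truncn (fine (tau w) * n.+1%:R))) w else 0.
have [_ _ Fmono] := filF.
have grid0 n k : 0 <= grid n k by rewrite le_min t0 divr_ge0.
have gridt n k : grid n k <= t by rewrite ge_min lexx.
have taule := @enlargement_le _ _ _ Ft tau t t (lexx t).
apply/(measurable_wrtP _ (subG t0)).
apply: (@measurable_fun_cvg _ (g_sigma_algebraType (Gt t)) R setT Y).
  move=> n _ B mB; rewrite setTI (measurable_gE (subG t0)).
  pose D k := [set w | (tau w <= t%:E)%E] `&`
    ([set w | ((k%:R / n.+1%:R)%:E <= mine (tau w) t%:E)%E] `\`
     [set w | ((k.+1%:R / n.+1%:R)%:E <= mine (tau w) t%:E)%E]).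
  have DE k w : (tau w <= t%:E)%E ->
      D k w <-> Num.truncn (fine (tau w) * n.+1%:R) = k.
    move=> tw; rewrite /D/= (min_idPl tw).
    case: (tau w) (tau0 w) tw => [r| |] //=; rewrite !lee_fin => r0 rt.
    rewrite !ler_pdivrMr//; split.
      by case=> _ [kr /negP]; rewrite -ltNge => rk; apply: truncn_def; rewrite kr.
    move=> <-; have rn0 : 0 <= r * n.+1%:R by rewrite mulr_ge0.
    by have /andP[-> rk] := truncn_itv rn0; split => //; split => //; apply/negP; rewrite -ltNge.
  have GD k : Gt t (D k).
    apply: (sub_sigmaI (subG t0) taule); apply: (sub_sigmaD (subG t0)).
      have := @enlargement_min _ _ _ Ft tau t
        [set` `[(k%:R / n.+1%:R)%:E, +oo[] (emeasurable_itv _).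
      by congr Gt; apply/seteqP; split => w /=; rewrite in_itv/= andbT.
    have := @enlargement_min _ _ _ Ft tau t
      [set` `[(k.+1%:R / n.+1%:R)%:E, +oo[] (emeasurable_itv _).
    by congr Gt; apply/seteqP; split => w /=; rewrite in_itv/= andbT.
  have -> : Y n @^-1` B =
      (\bigcup_k (D k `&` [set w | B (X (grid n k) w)])) `|`
      (~` [set w | (tau w <= t%:E)%E] `&` [set _ | B 0]).
    apply/seteqP; split => w /=; rewrite /Y.
      case: ifPn => tw BX; last by right; split => //; apply/negP.
      by left; exists (Num.truncn (fine (tau w) * n.+1%:R)) => //; split => //; apply/DE.
    case=> [[k _ [Dk BX]]|[/negP/negbTE-> //]].
    by have tw := Dk.1; rewrite tw (DE k w tw).1.
  apply: (sub_sigmaU (subG t0)).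
    apply: (sub_sigma_bigcup (subG t0)) => k; apply: (sub_sigmaI (subG t0)) => //.
    apply: (filtration_enlargement usualF t0); apply: (Fmono _ _ (grid0 n k) (gridt n k)).
    by apply: (adX _ (grid0 n k)); exists B => //; rewrite setTI.
  apply: (sub_sigmaI (subG t0)); first exact: (sub_sigmaC (subG t0)).
  have [B0|B0] := pselect (B 0).
    by have := sub_sigmaT (subG t0); congr Gt; apply/seteqP; split.
  by have := sub_sigma0 (subG t0); congr Gt; apply/seteqP; split.
move=> w _; rewrite /Y; case: ifPn => tw; last exact: cvg_cst.
have [+ _] := cX w.
case: (tau w) (tau0 w) tw => [r| |] //=; rewrite !lee_fin => r0.
rewrite le_eqVlt => /predU1P[->|rt] H.
  (* At tau = t the cap makes every sampling time equal to t, so the sequence is constant. *)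
  have gt n : grid n (Num.truncn (t * n.+1%:R)) = t.
    apply/min_idPl; have tn0 : 0 <= t * n.+1%:R by rewrite mulr_ge0.
    by rewrite ler_pdivlMr// ltW//; case/andP: (truncn_itv tn0).
  by under eq_fun do rewrite gt; exact: cvg_cst.
have [] := cvg_at_rightP (X ^~ w) r (X r w).
move=> + _ => /(_ (H r r0)); apply.
by have [G1 G2] := @cvg_grid_right t r (introT andP (conj r0 rt)).
Qed.

(** Two generation arguments, one inside the other: over the generators of F_tau, then over the
    optional sets, evaluated along the graph of tau up to time t. On the generating cadlag processes
    the claim is [cadlag_sample]. *)
Lemma sigma_at_trace_le t A : 0 <= t -> sigma_at Ft tau A ->
  Gt t (A `&` [set w | (tau w <= t%:E)%E]).
Proof.
move=> t0; have taule := @enlargement_le _ _ _ Ft tau t t (lexx t).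
pose K := [set A | Gt t (A `&` [set w | (tau w <= t%:E)%E])].
suff : sigma_at Ft tau `<=` K by apply.
apply: smallest_sub.
  split.
  - by rewrite /K/= set0I; exact: sub_sigma0 (subG t0).
  - move=> B KB; rewrite /K/=.
    have := sub_sigmaD (subG t0) taule KB; congr Gt; apply/seteqP; split => w /=.
      by move=> [tw BCw]; split => //; split => // Bw; apply: BCw.
    by move=> [[_ Bw] tw]; split => // -[].
  - move=> B KB; rewrite /K/= setI_bigcupl.
    exact: sub_sigma_bigcup (subG t0) KB.
move=> _ [z [zoo [oz _ [B mB <-]]]]; rewrite /K/= setTI.
pose L := [set D : set (R * T) |
  Gt t [set w | (tau w <= t%:E)%E /\ D (fine (tau w), w)]].
have tfin w : (tau w <= t%:E)%E -> tau w = (fine (tau w))%:E.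
  by case: (tau w) (tau0 w).
have tf0 w : 0 <= fine (tau w) by rewrite fine_ge0.
suff LO : optional_sigma Ft `<=` L.
  have := LO _ (oz _ (ex_intro2 _ _ B mB erefl)); rewrite /L/=.
  congr Gt; apply/seteqP; split => w /=; rewrite /value_at.
    by move=> [tw [_ Bz]]; split => //; rewrite (tfin _ tw).
  move=> [+ tw]; rewrite {1}(tfin _ tw) => Bz; split => //; split => //.
  exact: tf0.
apply: smallest_sub.
  split.
  - have := sub_sigma0 (subG t0); rewrite /L/=; congr Gt.
    by apply/seteqP; split => w //= -[].
  - move=> D LD; rewrite /L/=.
    have := sub_sigmaD (subG t0) taule LD; congr Gt; apply/seteqP; split => w /=.
      move=> [tw BCw]; split => //; split; first exact: tf0.
      by move=> Bw; apply: BCw.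
    by move=> [tw [_ nD]]; split => // -[].
  - move=> D LD; rewrite /L/=.
    have := sub_sigma_bigcup (subG t0) LD; congr Gt; apply/seteqP; split => w /=.
      by move=> [i _ [tw Dw]]; split => //; exists i.
    by move=> [tw [i _ Dw]]; exists i.
move=> _ [X [adX cX] [V mV <-]]; rewrite /L/=.
have := cadlag_sample t0 adX cX (ex_intro2 _ _ V mV erefl).
move=> /(sub_sigmaI (subG t0) taule); congr Gt; apply/seteqP; split => w /=.
  by move=> [tw [_]]; rewrite tw => VX; split => //; split => //; exact: tf0.
by move=> [tw [_ VX]]; split => //; split => //; rewrite tw.
Qed.

End sigma_at.

(** * Avoidance of stopping times *)

Section avoidance.
Context d (T : measurableType d) (R : realType).
Variables (P : probability T R) (Ft : R -> set (set T)) (tau : T -> \bar R).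
Hypotheses (usualF : usual_conditions P Ft) (rt_tau : random_time tau)
  (A_tau : avoids_stopping_times P Ft tau).
Local Notation Gt := (progressive_enlargement Ft tau).
Implicit Types (A B D : set T) (s t u : R) (X : R -> T -> R).

Let filF : filtration Ft. Proof. by case: usualF. Qed.
Let mtau : measurable_fun setT tau. Proof. by case: rt_tau. Qed.
Let tau0 w : (0 <= tau w)%E. Proof. by case: rt_tau. Qed.
Let subF t : 0 <= t -> sub_sigma (Ft t).
Proof. by move=> t0; apply: (filtration_sub filF). Qed.

Lemma avoids_cst (c : \bar R) : (0 <= c)%E -> P [set w | tau w = c] = 0%E.
Proof.
move=> c0; apply: (A_tau (S := cst c)); split => //= t t0.
have [ct|ct] := boolP (c <= t%:E)%E.
  by have := sub_sigmaT (subF t0); congr Ft; apply/seteqP; split.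
by have := sub_sigma0 (subF t0); congr Ft; apply/seteqP; split.
Qed.

Lemma sub_sigma_infty_enlargement : sub_sigma (sigma_infty Gt).
Proof. exact: sigma_infty_sub (enlargement_filtration usualF rt_tau). Qed.

Lemma enlargement_sigma_infty t : 0 <= t -> Gt t `<=` sigma_infty Gt.
Proof. by move=> t0 A GA; apply: sub_sigma_algebra; exists t. Qed.

Lemma sigma_infty_enlargement : sigma_infty Ft `<=` sigma_infty Gt.
Proof.
apply: smallest_sub; first exact: smallest_sigma_algebra.
move=> A [t t0 FA]; apply: (enlargement_sigma_infty t0).
exact: (filtration_enlargement usualF t0).
Qed.

(** The traces on {tau <= n} are in G_n. What remains lies in {tau = +oo}, null because tau avoids
    the constant time +oo, and null sets belong to F_0. *)
Lemma sigma_at_sigma_infty : sigma_at Ft tau `<=` sigma_infty Gt.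
Proof.
move=> A SA; have sGoo := sub_sigma_infty_enlargement.
have -> : A = (\bigcup_n (A `&` [set w | (tau w <= n%:R%:E)%E])) `|`
    (A `&` [set w | tau w = +oo%E]).
  apply/seteqP; split => w.
    move=> Aw; have := tau0 w; case E : (tau w) => [r| |] //= r0; last by right.
    left; exists (Num.truncn r).+1 => //; split => //=.
    by rewrite E lee_fin ltW //; case/andP: (truncn_itv r0).
  by case=> [[n _ []]|[]].
apply: (sub_sigmaU sGoo).
  apply: (sub_sigma_bigcup sGoo) => n.
  by apply: (@enlargement_sigma_infty n%:R) => //; exact: (sigma_at_trace_le usualF rt_tau).
apply: (enlargement_sigma_infty (lexx 0)).
apply: (filtration_enlargement usualF (lexx 0)).
case: usualF => _ _; apply; exists [set w | tau w = +oo%E]; split => //.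
- by have := mtau measurableT (emeasurable_set1 +oo%E); rewrite setTI.
- exact: avoids_cst.
Qed.

Lemma sub_sigma_at : sub_sigma (sigma_at Ft tau).
Proof.
apply: sub_sigma_generated => A HA.
apply: sub_sigma_infty_enlargement.2; apply: sigma_at_sigma_infty.
exact: sub_sigma_algebra.
Qed.

(** For A in F_s with s <= c this process is also adapted, and at a finite tau its value is the
    indicator of A and {c <= tau}: events of F_tau are built from it. *)
Lemma delayed_indicator_cadlag (A : set T) (c : R) :
  cadlag (fun t w => if c <= t then \1_A w else 0 : R).
Proof.
move=> w; split=> t t0.
  have [ct|ct] := leP c t.
    apply: cvg_near_cst; near=> s.
    by rewrite (le_trans ct)//; near: s; exact: nbhs_right_ge.
  apply: cvg_near_cst; near=> s.
  by rewrite leNgt ifF//; apply/negbTE; rewrite negbK; near: s; exact: nbhs_right_lt.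
have [ct|ct] := ltP c t.
  apply: (cvgP (\1_A w : R)); apply: cvg_near_cst; near=> s.
  by rewrite ifT//; near: s; exact: nbhs_left_ge.
apply: (cvgP (0 : R)); apply: cvg_near_cst; near=> s.
rewrite ifF//; apply/negbTE; rewrite -ltNge; exact: (@lt_le_trans _ _ t).
Unshelve. all: by end_near. Qed.

(** The indicator of ]s, t] is not right-continuous, so the interval is assembled from half-lines
    [c, +oo[: strict inequalities by countable unions, the upper bound by a difference. *)
Lemma sigma_at_interval s t A : 0 <= s -> Ft s A ->
  sigma_at Ft tau (A `&` [set w | (s%:E < tau w <= t%:E)%E]).
Proof.
move=> s0 FA; have sS := sub_sigma_at.
have [_ _ Fmono] := filF.
have H1 c B : s <= c -> Ft s B ->
    sigma_at Ft tau (B `&` [set w | (c%:E <= tau w)%E] `&` [set w | (tau w < +oo)%E]).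
  move=> sc FB; have c0 := le_trans s0 sc.
  apply: sub_sigma_algebra.
  pose z (t : R) w := if c <= t then \1_B w else 0 : R.
  (* The value 0 at time +oo is what removes {tau = +oo} from the event. *)
  exists z, (cst 0); split.
  - move=> _ [V mV <-]; apply: sub_sigma_algebra; exists z.
      split; last exact: delayed_indicator_cadlag.
      move=> u u0; rewrite /z; have [cu|cu] := leP c u.
        apply: measurable_wrt_indic; first exact: subF.
        by apply: Fmono FB => //; exact: le_trans cu.
      exact: measurable_wrt_cst (subF u0).
    by exists V.
  - apply: measurable_wrt_cst; exact: sigma_infty_sub filF.
  - exists [set 1]; first exact: measurable_set1.
    rewrite setTI /value_at /z; apply/seteqP; split => w /=.
      have := tau0 w; case: (tau w) => [r| |] //= r0; last by move/esym/eqP; rewrite oner_eq0.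
      rewrite lee_fin indicE ltry; case: ifP => cr; last by move/esym/eqP; rewrite oner_eq0.
      case: (boolP (w \in B)) => [|_]; last by move/esym/eqP; rewrite oner_eq0.
      by rewrite inE.
    move=> [[Bw]]; have := tau0 w; case: (tau w) => [r| |] //= r0.
    by rewrite lee_fin => -> _; rewrite indicE mem_set.
have H2 c B : s <= c -> Ft s B ->
    sigma_at Ft tau (B `&` [set w | (c%:E < tau w)%E] `&` [set w | (tau w < +oo)%E]).
  move=> sc FB.
  have Hn n : s <= c + n.+1%:R^-1 by rewrite (le_trans sc)// lerDl invr_ge0.
  have := sub_sigma_bigcup sS (fun n => H1 _ B (Hn n) FB).
  congr (sigma_at Ft tau); apply/seteqP; split => w /=.
    move=> [n _ [[Bw cw] tw]]; split => //; split => //; apply: lt_le_trans cw.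
    by rewrite lte_fin ltrDl invr_gt0.
  move=> [[Bw]]; have := tau0 w; case E : (tau w) => [r| |] //= r0.
  rewrite lte_fin => cr _.
  have [m tm] : exists n, n.+1%:R^-1 <= r - c by apply: exists_invS_le; rewrite subr_gt0.
  by exists m => //=; rewrite E lee_fin ltry -lerBrDl.
have [ts|st] := ltP t s.
  have := sub_sigma0 sS; congr (sigma_at Ft tau); apply/seteqP; split => w //=.
  by move=> [_ /andP[st /(lt_le_trans st)]]; rewrite lte_fin ltNge (ltW ts).
have := sub_sigmaD sS (H2 s A (lexx s) FA) (H2 t A st FA).
congr (sigma_at Ft tau); apply/seteqP; split => w /=.
  move=> [[[Aw ->] tw] H]; split => //=; rewrite leNgt; apply/negP => tt; exact: H.
move=> [Aw /andP[sw tw]]; split; first by split => //; exact: le_lt_trans (ltry t).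
by move=> [[_ +] _]; rewrite ltNge tw.
Qed.

(** A pi-system generating G_oo; the events A alone stand for r = +oo. *)
Definition time_rectangles : set (set T) :=
  [set B | exists2 s, 0 <= s & exists2 A, Ft s A &
     B = A \/ exists2 r, 0 <= r & B = A `&` [set w | (tau w <= r%:E)%E]].

Lemma measurable_tau_le (r : R) : measurable [set w | (tau w <= r%:E)%E].
Proof. by rewrite -[X in measurable X]setTI; exact: emeasurable_fun_infty_c. Qed.

Lemma time_rectangles_measurable : time_rectangles `<=` measurable.
Proof.
move=> B [s s0 [A FA [->|[r r0 ->]]]]; first exact: (subF s0).2.
by apply: measurableI; [exact: (subF s0).2|exact: measurable_tau_le].
Qed.

Lemma time_rectanglesI : setI_closed time_rectangles.
Proof.
have [_ _ Fmono] := filF.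
have FI s s' A A' : 0 <= s -> 0 <= s' -> Ft s A -> Ft s' A' ->
    0 <= Num.max s s' /\ Ft (Num.max s s') (A `&` A').
  move=> s0 s0' FA FA'; have m0 : 0 <= Num.max s s' by rewrite le_max s0.
  split=> //; apply: (sub_sigmaI (subF m0)).
    by apply: Fmono FA => //; rewrite le_max lexx.
  by apply: Fmono FA' => //; rewrite le_max lexx orbT.
move=> B B' [s s0 [A FA H]] [s' s0' [A' FA' H']].
have [m0 FAA] := FI _ _ _ _ s0 s0' FA FA'.
exists (Num.max s s') => //; exists (A `&` A') => //.
case: H H' => [->|[r r0 ->]] [->|[r' r0' ->]]; [by left| | |]; right.
- by exists r' => //; rewrite setIA.
- by exists r => //; rewrite setIAC.
- exists (Num.min r r'); first by rewrite le_min r0.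
  rewrite setIACA; congr (_ `&` _); apply/seteqP; split => w /=.
    by move=> [wr wr']; rewrite EFin_min le_min wr.
  by rewrite EFin_min le_min => /andP.
Qed.

Lemma sigma_infty_rectangles : sigma_infty Gt `<=` <<s time_rectangles >>.
Proof.
have sK := sub_sigma_generated time_rectangles_measurable.
apply: smallest_sub; first exact: smallest_sigma_algebra.
(* One term of the intersection defining G_t is enough, here that of time t + 1. *)
move=> A [t /= t0] /(_ (t + 1)); rewrite /= ltrDl ltr01 => /(_ isT).
have t1 : 0 <= t + 1 by rewrite addr_ge0.
apply: smallest_sub; first exact: smallest_sigma_algebra.
move=> B [FB|].
  by apply: sub_sigma_algebra; exists (t + 1) => //; exists B => //; left.
move=> [V mV <-].
pose TK := g_sigma_algebraType time_rectangles.
have mtauK : measurable_fun (setT : set TK) (tau : TK -> \bar R).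
  apply: (measurability _ (ErealGenOInfty.measurableE R)) => //.
  move=> _ [_ [r ->] <-]; rewrite setTI.
  have [r0|r0] := leP 0 r; last first.
    have -> : tau @^-1` `]r%:E, +oo[%classic = setT.
      apply/seteqP; split => w //= _; rewrite in_itv/= andbT.
      by apply: lt_le_trans (tau0 w); rewrite lte_fin.
    exact: measurableT.
  have : time_rectangles [set w | (tau w <= r%:E)%E].
    exists 0 => //; exists setT; first exact: sub_sigmaT (subF (lexx 0)).
    by right; exists r => //; rewrite setTI.
  move=> /(@sub_sigma_algebra _ setT) /(sub_sigmaC sK) H; move: H.
  congr (<<s _ >>); apply/seteqP; split => w /=; rewrite in_itv/= andbT ltNge => /negP //.
have := @measurable_mine _ TK R setT tau (cst (t + 1)%:E) mtauK (@measurable_cst _ _ _ _ _ _).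
by apply.
Qed.

End avoidance.

(** * Conditional expectations of bounded variables *)

Section bounded_cond_exp.
Context d (T : measurableType d) (R : realType) (P : probability T R).
Implicit Types (S : set (set T)) (A B : set T) (X Y Z : T -> R).
Local Open Scope ereal_scope.

Lemma integral_cst1 A : measurable A -> \int[P]_(w in A) (1%R : R)%:E = P A.
Proof. by move=> mA; rewrite -[RHS]mul1e -integral_cst. Qed.

Lemma integral_le1_lty A Z : measurable A -> measurable_fun setT Z ->
  (forall w, 0 <= Z w <= 1)%R -> \int[P]_(w in A) (Z w)%:E <= 1.
Proof.
move=> mA mZ Z01; apply: (@le_trans _ _ (P A)); last exact: probability_le1.
rewrite -integral_cst1//; apply: ge0_le_integral => //.
- by move=> w _; rewrite lee_fin; case/andP: (Z01 w).
- by apply: measurable_funTS; exact/measurable_EFinP.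
- by move=> w _; rewrite lee_fin; case/andP: (Z01 w).
Qed.

(** Tested on the events {X - Y >= 1/(n+1)}, the inequality of integrals forces each of them to be
    null. *)
Lemma ae_le_integral_sub S X Y : sub_sigma S ->
  measurable_wrt S X -> (forall w, 0 <= X w)%R ->
  measurable_wrt S Y -> (forall w, 0 <= Y w)%R -> \int[P]_w (Y w)%:E < +oo ->
  (forall A, S A -> \int[P]_(w in A) (X w)%:E <= \int[P]_(w in A) (Y w)%:E) ->
  {ae P, forall w, (X w <= Y w)%R}.
Proof.
move=> sS mX X0 mY Y0 iY XY.
have mX' := measurable_wrt_fun sS mX; have mY' := measurable_wrt_fun sS mY.
pose C n := [set w | (n.+1%:R^-1 <= X w - Y w)%R].
have SC n : S (C n) by apply: measurable_wrt_ge => //; exact: measurable_wrtB.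
have PC n : P (C n) = 0.
  have mC : measurable (C n) by exact: sS.2.
  have iC : \int[P]_(w in C n) (Y w)%:E \is a fin_num.
    rewrite ge0_fin_numE; first exact: integral_lty_subset.
    by apply: integral_ge0 => w _; rewrite lee_fin.
  have : \int[P]_(w in C n) (Y w)%:E + (n.+1%:R^-1)%:E * P (C n) <=
      \int[P]_(w in C n) (Y w)%:E.
    apply: le_trans (XY _ (SC n)).
    rewrite -integral_cst// -ge0_integralD//; last 3 first.
    - by move=> w _; rewrite lee_fin.
    - by apply: measurable_funTS; exact/measurable_EFinP.
    - by move=> w _ /=; rewrite lee_fin invr_ge0.
    apply: ge0_le_integral => //.
    - by move=> w _ /=; rewrite -EFinD lee_fin addr_ge0// invr_ge0.
    - apply: emeasurable_funD; last exact: measurable_cst.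
      by apply: measurable_funTS; exact/measurable_EFinP.
    - by apply: measurable_funTS; exact/measurable_EFinP.
    - by move=> w Cw /=; rewrite -EFinD lee_fin addrC -lerBrDr.
  rewrite -leeBrDl// subee// => H.
  apply/eqP; rewrite eq_le measure_ge0 andbT.
  by move: H; rewrite pmule_rle0// lte_fin invr_gt0.
have : P.-negligible (\bigcup_n C n).
  apply: negligible_bigcup => n; exists (C n); split; [exact: sS.2|exact: PC|by []].
move=> negC; apply: negligibleS negC => w /= /negP.
rewrite -ltNge -subr_gt0 => /exists_invS_le[n H].
by exists n.
Qed.

(** A version capped at 1, so that the bounds on predictions hold at every point and not only almost
    surely. *)
Lemma cond_exp_exists01 S X : sub_sigma S ->
  measurable_fun setT X -> (forall w, 0 <= X w <= 1)%R ->
  exists Y, [/\ measurable_wrt S Y, (forall w, 0 <= Y w <= 1)%R &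
    forall A, S A -> \int[P]_(w in A) (X w)%:E = \int[P]_(w in A) (Y w)%:E].
Proof.
move=> sS mX X01; have X0 w : (0 <= X w)%R by case/andP: (X01 w).
have [|Y [mY Y0 YE]] := @cond_exp_exists _ _ _ P S X sS mX X0.
  by apply: (@le_lt_trans _ _ 1); [exact: integral_le1_lty|rewrite ltry].
have Y1 : {ae P, forall w, (Y w <= 1)%R}.
  apply: (ae_le_integral_sub sS mY Y0 (@measurable_wrt_cst _ _ _ S 1%R sS)) => //.
    by rewrite integral_cst1// probability_setT ltry.
  move=> A SA; have mA := sS.2 _ SA; rewrite -YE//; apply: ge0_le_integral => //.
  - by move=> w _; rewrite lee_fin.
  - by apply: measurable_funTS; exact/measurable_EFinP.
  - by apply/measurable_EFinP; exact: measurable_cst.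
  - by move=> w _; rewrite lee_fin; case/andP: (X01 w).
have m1 : measurable_fun setT (fun x : R => Num.min x 1%R).
  by apply: (@measurable_minr _ _ _ setT id (cst 1%R)).
have mY1 := measurable_wrt_comp sS m1 mY.
exists (fun w => Num.min (Y w) 1%R); split => //.
  by move=> w; rewrite le_min Y0 ler01 ge_min lexx orbT.
move=> A SA; have mA := sS.2 _ SA; rewrite YE//.
apply: ge0_ae_eq_integral => //.
- by apply: measurable_funTS; apply/measurable_EFinP; exact: measurable_wrt_fun mY.
- by apply: measurable_funTS; apply/measurable_EFinP; exact: measurable_wrt_fun mY1.
- by move=> w _; rewrite lee_fin.
- by move=> w _; rewrite lee_fin le_min Y0 ler01.
- by apply: filterS Y1 => w /= wY _; rewrite (min_idPl wY).
Qed.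

Lemma integral_tail_cvg0 (g : T -> R) : measurable_fun setT g ->
  (forall w, 0 <= g w)%R -> \int[P]_w (g w)%:E < +oo ->
  \int[P]_w (g w * \1_[set w | (n%:R < g w)%R] w)%:E @[n --> \oo] --> 0.
Proof.
move=> mg g0 ig.
have mC n : measurable [set w | (n%:R < g w)%R].
  have -> : [set w | (n%:R < g w)%R] = setT `&` g @^-1` `]n%:R, +oo[.
    by rewrite setTI; apply/seteqP; split => w /=; rewrite in_itv/= andbT.
  exact: mg.
have := @dominated_cvg _ _ _ P setT measurableT
  (fun n w => (g w * \1_[set w | (n%:R < g w)%R] w)%:E) (cst 0) (EFin \o g).
rewrite integral_cst// mul0e; apply.
- move=> n; apply/measurable_EFinP; apply: measurable_funM => //.
- move=> w _ /=; apply: cvg_near_cst; near=> n.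
  rewrite indicE memNset ?mulr0//=; apply/negP; rewrite -leNgt.
  by near: n; exact: nbhs_infty_ger.
- by [].
- exact: integrable_rv_ge0.
- move=> n w _ /=; rewrite lee_fin ger0_norm ?mulr_ge0//.
  by rewrite ler_piMr// indicE; case: (_ \in _).
Unshelve. all: by end_near. Qed.

End bounded_cond_exp.

(** * Absence of jumps of the conditional distribution *)

Section grid.
Context (R : realType) (r : R).
Hypothesis r0 : 0 < r.

(** Dyadic, so that each grid refines the previous one and the first hits below are monotone in
    n. *)
Definition grid (n k : nat) : R := r * k%:R / 2 ^+ n.

Lemma grid0 n : grid n 0 = 0.
Proof. by rewrite /grid mulr0 mul0r. Qed.

Lemma grid_top n : grid n (2 ^ n)%N = r.
Proof. by rewrite /grid natrX mulfK// expf_neq0// pnatr_eq0. Qed.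

Lemma grid_double n k : grid n.+1 k.*2 = grid n k.
Proof.
by rewrite /grid -mul2n natrM exprS mulrCA -mulf_div divff ?mul1r// pnatr_eq0.
Qed.

Lemma gridS n k : grid n k.+1 = grid n k + r / 2 ^+ n.
Proof. by rewrite /grid -natr1 mulrDr mulr1 mulrDl. Qed.

Lemma grid_le n i j : (i <= j)%N -> grid n i <= grid n j.
Proof.
by move=> ij; rewrite /grid ler_wpM2r ?invr_ge0 ?exprn_ge0// ler_wpM2l ?ler_nat// ltW.
Qed.

Lemma grid_ge0 n k : 0 <= grid n k.
Proof. by rewrite -(grid0 n); exact: grid_le. Qed.

Lemma grid_mesh (x : R) : 0 < x -> exists N, forall n, r / 2 ^+ (N + n) <= x.
Proof.
move=> x0; have [N Nx] := exists_invS_le (divr_gt0 x0 r0).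
exists N => n; rewrite mulrC -ler_pdivlMr//; apply: le_trans Nx.
rewrite lef_pV2 ?posrE ?exprn_gt0// -natrX ler_nat.
by apply: leq_trans (ltn_expl (N + n) (ltnSn 1)); rewrite ltnS leq_addr.
Qed.

End grid.

(** N is the default value when no index below N satisfies p; hence [p m] is claimed only if m <
    N. *)
Lemma find_iota_spec (p : pred nat) N (m := find p (iota 0 N)) :
  [/\ (m <= N)%N, (m < N)%N -> p m & forall k, (k < N)%N -> p k -> (m <= k)%N].
Proof.
have mN : (m <= N)%N by rewrite -[leqRHS](size_iota 0) find_size.
split=> // [mlt|k kN pk].
  have hp : has p (iota 0 N) by rewrite has_find size_iota.
  by have := nth_find 0%N hp; rewrite nth_iota.
rewrite leqNgt; apply/negP => km.
by have := before_find 0%N km; rewrite nth_iota// add0n pk.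
Qed.

(** * The conditional distribution of tau along dyadic grids *)

Section compensator.
Context d (T : measurableType d) (R : realType).
Variables (P : probability T R) (Ft : R -> set (set T)) (tau : T -> \bar R).
Hypotheses (usualF : usual_conditions P Ft) (rt_tau : random_time tau)
  (immP : immersed P Ft (progressive_enlargement Ft tau)).
Local Notation Gt := (progressive_enlargement Ft tau).
Local Notation Foo := (sigma_infty Ft).
Implicit Types (B C D : set T) (s t u : R) (X : R -> T -> R).

Let filF : filtration Ft. Proof. by case: usualF. Qed.
Let subF t : 0 <= t -> sub_sigma (Ft t).
Proof. by move=> t0; apply: (filtration_sub filF). Qed.
Let subG t : 0 <= t -> sub_sigma (Gt t).
Proof. by move=> t0; apply: (enlargement_sub usualF rt_tau). Qed.
Let subFoo : sub_sigma Foo. Proof. exact: sigma_infty_sub filF. Qed.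
Let indic01 B w : 0 <= (\1_B w : R) <= 1.
Proof. by rewrite indicE; case: (_ \in _); rewrite ?lexx ler01. Qed.
Let mtaule t : measurable [set w | (tau w <= t%:E)%E].
Proof. exact: measurable_tau_le. Qed.

Lemma conditional_distribution u : 0 <= u ->
  exists a : T -> R, [/\ measurable_wrt (Ft u) a, (forall w, 0 <= a w <= 1) &
    forall C, Foo C -> (\int[P]_(w in C) (\1_[set w | (tau w <= u%:E)%E] w)%:E =
      \int[P]_(w in C) (a w)%:E)%E].
Proof.
move=> u0; have mi : measurable_fun setT (\1_[set w | (tau w <= u%:E)%E] : T -> R).
  exact: measurable_indic.
have [a [ma a01 aE]] := cond_exp_exists01 P (subF u0) mi (indic01 _).
exists a; split=> //.
apply: (immersed_cond_exp filF subG immP u0) => //.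
- apply: measurable_wrt_indic; first exact: subG.
  exact: enlargement_le.
- by apply: (@le_lt_trans _ _ 1%E); [exact: integral_le1_lty|rewrite ltry].
- by move=> w; case/andP: (a01 w).
Qed.

(** [A n k] is P[tau <= t | F_oo] at the k-th point t of the n-th grid, in an F_t-measurable
    version. The second clause makes the grids share one process; monotonicity and bounds hold at
    every point, so that increments are nonnegative and sum to at most 1 everywhere. *)
Definition is_compensator (r : R) (A : nat -> nat -> T -> R) :=
  [/\ forall n k, measurable_wrt (Ft (grid r n k)) (A n k),
      forall n k, A n.+1 k.*2 = A n k,
      forall n k w, A n k w <= A n k.+1 w,
      forall n k w, 0 <= A n k w <= 1 &
      forall n k C, Foo C ->
        (\int[P]_(w in C) (\1_[set w | (tau w <= (grid r n k)%:E)%E] w)%:E =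
         \int[P]_(w in C) (A n k w)%:E)%E].

Lemma compensator_exists r : 0 < r -> exists A, is_compensator r A.
Proof.
move=> r0; have [_ _ Fmono] := filF.
have H u : exists a : T -> R, 0 <= u ->
  [/\ measurable_wrt (Ft u) a, (forall w, 0 <= a w <= 1) &
    forall C, Foo C -> (\int[P]_(w in C) (\1_[set w | (tau w <= u%:E)%E] w)%:E =
      \int[P]_(w in C) (a w)%:E)%E].
  have [u0|u0] := leP 0 u; last by exists (cst 0).
  by have [a Ha] := conditional_distribution u0; exists a.
(* One version is chosen per time, not per grid point: this gives the consistency between grids. *)
have [a aP] := choice H.
have g0 n k : 0 <= grid r n k by exact: grid_ge0.
have a0 n k w : 0 <= a (grid r n k) w.
  by have [_ /(_ w)/andP[] ] := aP _ (g0 n k).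
have ama n k : {ae P, forall w, a (grid r n k) w <= a (grid r n k.+1) w}.
  have [m1 _ E1] := aP _ (g0 n k); have [m2 b2 E2] := aP _ (g0 n k.+1).
  have gle : grid r n k <= grid r n k.+1 by exact: grid_le.
  apply: (ae_le_integral_sub (subF (g0 n k.+1))) => //.
  - by apply: measurable_wrt_le m1; exact: Fmono.
  - apply: (@le_lt_trans _ _ 1%E); last by rewrite ltry.
    apply: integral_le1_lty => //.
    by apply: measurable_wrt_fun m2; exact: subF.
  move=> C FC; have FooC : Foo C by exact: (filtration_sigma_infty (g0 n k.+1)).
  have mC : measurable C by exact: subFoo.2.
  rewrite -E1// -E2//; apply: ge0_le_integral => //.
  - by apply: measurable_funTS; apply/measurable_EFinP; exact: measurable_indic.
  - by apply: measurable_funTS; apply/measurable_EFinP; exact: measurable_indic.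
  - move=> w _; rewrite lee_fin !indicE; case: (boolP (w \in _)) => //.
    rewrite inE/= => tw; rewrite mem_set//=; apply: le_trans tw _.
    by rewrite lee_fin.
(* Countably many inequalities hold almost surely; where one fails is a null event, so [good] is in
   F_0 and multiplying by its indicator preserves adaptedness. *)
pose good := [set w | forall n k, a (grid r n k) w <= a (grid r n k.+1) w].
have Fgood : Ft 0 good.
  have : P.-negligible (~` good).
    have : {ae P, forall w n k, a (grid r n k) w <= a (grid r n k.+1) w}.
      by apply: ae_foralln => n; apply: ae_foralln => k; exact: ama.
    by [].
  case: usualF => _ _ neg /neg /(sub_sigmaC (subF (lexx 0))).
  by rewrite setCK.
exists (fun n k w => \1_good w * a (grid r n k) w); split.
- move=> n k; apply: measurable_wrtM; first exact: subF.
    apply: measurable_wrt_indic; first exact: subF.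
    exact: (Fmono 0).
  by have [] := aP _ (g0 n k).
- by move=> n k; rewrite grid_double.
- move=> n k w; rewrite indicE; case: (boolP (w \in good)) => [|_].
    by rewrite inE !mul1r; exact.
  by rewrite !mul0r.
- move=> n k w; rewrite indicE; case: (boolP (w \in good)) => [_|_].
    by rewrite !mul1r; have [] := aP _ (g0 n k).
  by rewrite !mul0r lexx ler01.
- move=> n k C FC; have [m1 _ ->//] := aP _ (g0 n k).
  have mC : measurable C by exact: subFoo.2.
  have ma : measurable_fun setT (a (grid r n k)).
    by apply: measurable_wrt_fun m1; exact: subF.
  have mg : measurable good by exact: (subF (lexx 0)).2.
  apply: ge0_ae_eq_integral => //.
  + by apply: measurable_funTS; exact/measurable_EFinP.
  + apply: measurable_funTS; apply/measurable_EFinP.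
    by apply: measurable_funM => //; exact: measurable_indic.
  + by move=> w _; rewrite lee_fin.
  + by move=> w _; rewrite lee_fin mulr_ge0.
  + have : {ae P, forall w n k, a (grid r n k) w <= a (grid r n k.+1) w}.
      by apply: ae_foralln => i; apply: ae_foralln => j; exact: ama.
    by apply: filterS => w gw _; rewrite indicE mem_set// mul1r.
Qed.

End compensator.

(** * Large increments of A and the stopping time they would produce *)

Section no_jump.
Context d (T : measurableType d) (R : realType).
Variables (P : probability T R) (Ft : R -> set (set T)) (tau : T -> \bar R).
Hypotheses (usualF : usual_conditions P Ft) (rt_tau : random_time tau)
  (A_tau : avoids_stopping_times P Ft tau).
Variables (r : R) (A : nat -> nat -> T -> R).
Hypotheses (r0 : 0 < r) (HA : is_compensator P Ft tau r A).
Local Notation Foo := (sigma_infty Ft).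
Implicit Types (B C D : set T) (s t u : R).

Let filF : filtration Ft. Proof. by case: usualF. Qed.
Let mtau : measurable_fun setT tau. Proof. by case: rt_tau. Qed.
Let subF t : 0 <= t -> sub_sigma (Ft t).
Proof. by move=> t0; apply: (filtration_sub filF). Qed.
Let subFoo : sub_sigma Foo. Proof. exact: sigma_infty_sub filF. Qed.
Let mtaule t : measurable [set w | (tau w <= t%:E)%E].
Proof. exact: measurable_tau_le. Qed.
Let g0 n k : 0 <= grid r n k. Proof. exact: grid_ge0. Qed.

Definition increment n k w := A n k.+1 w - A n k w.
Definition interval_event n k :=
  [set w | ((grid r n k)%:E < tau w <= (grid r n k.+1)%:E)%E].
Local Notation inc := increment.
Local Notation I := interval_event.

Lemma interval_eventE n k : I n k =
  [set w | (tau w <= (grid r n k.+1)%:E)%E] `\` [set w | (tau w <= (grid r n k)%:E)%E].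
Proof.
apply/seteqP; split => w /=; rewrite /I/= ltNge.
  by move=> /andP[/negP].
by move=> [-> /negP ->].
Qed.

Lemma measurable_interval_event n k : measurable (I n k).
Proof. by rewrite interval_eventE; exact: measurableD. Qed.

Lemma measurable_increment n k : measurable_wrt (Ft (grid r n k.+1)) (inc n k).
Proof.
have [mA _ _ _ _] := HA; have [_ _ Fmono] := filF.
apply: measurable_wrtB => //; first exact: subF.
by apply: measurable_wrt_le (mA n k); apply: Fmono => //; exact: grid_le.
Qed.

Lemma measurable_increment_infty n k : measurable_wrt Foo (inc n k).
Proof.
by apply: measurable_wrt_le (@measurable_increment n k); exact: filtration_sigma_infty.
Qed.

Lemma increment_ge0 n k w : 0 <= inc n k w.
Proof. by have [_ _ mA _ _] := HA; rewrite subr_ge0. Qed.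

Lemma increment_le1 n k w : inc n k w <= 1.
Proof.
have [_ _ _ A01 _] := HA; rewrite /inc.
have /andP[_ h1] := A01 n k.+1 w; have /andP[h2 _] := A01 n k w; lra.
Qed.

Lemma increment_double n k w : inc n k w = inc n.+1 k.*2 w + inc n.+1 k.*2.+1 w.
Proof.
have [_ AE _ _ _] := HA.
by rewrite /inc -(AE n k) -(AE n k.+1) doubleS; lra.
Qed.

Lemma sum_increment n N w : \sum_(k < N) inc n k w <= 1.
Proof.
have [_ _ _ A01 _] := HA.
have -> : \sum_(k < N) inc n k w = A n N w - A n 0%N w.
  by rewrite -(big_mkord xpredT (fun k => inc n k w)) telescope_sumr.
have /andP[_ h1] := A01 n N w; have /andP[h2 _] := A01 n 0%N w; lra.
Qed.

Lemma indic_interval n k w : \1_(I n k) w =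
  \1_[set w | (tau w <= (grid r n k.+1)%:E)%E] w -
  \1_[set w | (tau w <= (grid r n k)%:E)%E] w :> R.
Proof.
have memE (b : pred T) : (w \in [set w | b w]) = b w by apply/idP/idP; rewrite inE.
rewrite interval_eventE !indicE in_setD.
rewrite (memE (fun w => tau w <= _)%E) (memE (fun w => tau w <= (grid r n k)%:E)%E).
case: (boolP (tau w <= (grid r n k)%:E)%E) => h1; last by rewrite subr0 andbT.
have -> : (tau w <= (grid r n k.+1)%:E)%E.
  by apply: le_trans h1 _; rewrite lee_fin; exact: grid_le.
by rewrite subrr.
Qed.

Lemma integral_increment n k C : Foo C ->
  (\int[P]_(w in C) (\1_(I n k) w)%:E = \int[P]_(w in C) (inc n k w)%:E)%E.
Proof.
move=> FC; have [mA _ AA A01 AE] := HA; have mC := subFoo.2 _ FC.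
have mAf j : measurable_fun setT (A n j).
  by apply: measurable_wrt_fun (mA n j); exact: subF.
have E1 : (\int[P]_(w in C) (\1_[set w | (tau w <= (grid r n k.+1)%:E)%E] w)%:E =
    \int[P]_(w in C) (\1_[set w | (tau w <= (grid r n k)%:E)%E] w : R)%:E +
    \int[P]_(w in C) (\1_(I n k) w)%:E)%E.
  rewrite -ge0_integralD//; last 2 first.
  - by apply/measurable_EFinP; exact: measurable_indic.
  - by apply/measurable_EFinP; apply: measurable_indic; exact: measurable_interval_event.
  by apply: eq_integral => w _; rewrite -EFinD indic_interval addrC subrK.
have E2 : (\int[P]_(w in C) (A n k.+1 w)%:E =
    \int[P]_(w in C) (A n k w)%:E + \int[P]_(w in C) (inc n k w)%:E)%E.
  rewrite -ge0_integralD//; last 4 first.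
  - by move=> w _; rewrite lee_fin; case/andP: (A01 n k w).
  - by apply: measurable_funTS; exact/measurable_EFinP.
  - by move=> w _; rewrite lee_fin increment_ge0.
  - apply: measurable_funTS; apply/measurable_EFinP.
    exact: measurable_wrt_fun (@measurable_increment_infty n k).
  by apply: eq_integral => w _; rewrite -EFinD /inc addrC subrK.
move: E1; rewrite AE// E2 AE// => /esym; apply: fin_num_addeI.
rewrite ge0_fin_numE; last first.
  by apply: integral_ge0 => w _; rewrite lee_fin; case/andP: (A01 n k w).
by apply: (@le_lt_trans _ _ 1%E); [exact: integral_le1_lty|rewrite ltry].
Qed.

Section hit.
Variable eps : R.
Hypothesis eps0 : 0 < eps.

(** When no increment reaches [eps] the index is [2 ^ n], and the corresponding [hit_time] is r. *)
Definition first_hit n w := find (fun k => eps <= inc n k w) (iota 0 (2 ^ n)%N).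
Local Notation kappa := first_hit.
Definition hit n := [set w | (kappa n w < 2 ^ n)%N].
Definition hit_time n w := grid r n (kappa n w).
Local Notation L := hit_time.

(** The increment of A over half a cell is at most that over the whole cell, so a hit at level n+1
    forces one at level n in the parent cell: refining can only delay the first hit. *)
Lemma first_hit_double n w : ((kappa n w).*2 <= kappa n.+1 w)%N.
Proof.
have [le1 lt1 min1] := find_iota_spec (fun k => eps <= inc n k w) (2 ^ n).
have [le2 lt2 min2] := find_iota_spec (fun k => eps <= inc n.+1 k w) (2 ^ n.+1).
rewrite -/(kappa n w) in le1 lt1 min1; rewrite -/(kappa n.+1 w) in le2 lt2 min2.
have [jlt|jge] := ltnP (kappa n.+1 w) (2 ^ n.+1)%N; last first.
  by apply: leq_trans jge; rewrite -mul2n expnS leq_mul2l le1.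
set j := kappa n.+1 w in jlt lt2 *.
rewrite -geq_half_double; apply: min1.
  by rewrite ltn_half_double -mul2n -expnS.
apply: le_trans (lt2 jlt) _; rewrite [leRHS]increment_double.
rewrite -[in leLHS](odd_double_half j); case: (odd j) => /=.
  by rewrite add1n lerDr increment_ge0.
by rewrite add0n lerDl increment_ge0.
Qed.

Lemma hit_time_homo w : {homo L^~ w : m n / (m <= n)%N >-> m <= n}.
Proof.
apply: (@homo_leq _ (L^~ w) <=%O) => [x|y x z|n]; [exact: lexx|exact: le_trans|].
by rewrite /L -grid_double; apply: grid_le => //; exact: first_hit_double.
Qed.

Lemma hit_time_le n w : L n w <= r.
Proof.
rewrite /L -[leRHS](grid_top r n); apply: grid_le => //.
by have [] := find_iota_spec (fun k => eps <= inc n k w) (2 ^ n).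
Qed.

Lemma hit_timeP n t w : t < r -> L n w <= t <->
  exists k, [/\ (k < 2 ^ n)%N, grid r n k <= t & eps <= inc n k w].
Proof.
move=> tr; have [le1 lt1 min1] := find_iota_spec (fun k => eps <= inc n k w) (2 ^ n).
rewrite -/(kappa n w) in le1 lt1 min1; split.
  move=> Lt; have kn : (kappa n w < 2 ^ n)%N.
    rewrite ltn_neqAle le1 andbT; apply/eqP => kn.
    by move: Lt; rewrite /L kn grid_top leNgt tr.
  by exists (kappa n w); split => //; exact: lt1.
move=> [k [kn kt ek]]; apply: le_trans kt; apply: grid_le => //.
exact: min1.
Qed.

Definition hit_limit w : \bar R := ereal_sup [set (L n w)%:E | n in setT].

Lemma hit_limit_stopping : stopping_time Ft hit_limit.
Proof.
have [_ _ Fmono] := filF; have [_ Frc _] := usualF.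
split=> [w|t t0].
  apply: (@le_trans _ _ (L 0 w)%:E); first by rewrite lee_fin; exact: g0.
  by apply: ereal_sup_ubound; exists 0%N.
have E : [set w | (hit_limit w <= t%:E)%E] = \bigcap_n [set w | L n w <= t].
  apply/seteqP; split => w /= H.
    move=> n _ /=; rewrite -lee_fin; apply: le_trans H.
    by apply: ereal_sup_ubound; exists n.
  by apply: ge_ereal_sup => _ [n _ <-]; rewrite lee_fin; exact: H.
rewrite E; have [rt|tr] := leP r t.
  have := sub_sigmaT (subF t0); congr Ft; apply/seteqP; split => w // _ n _ /=.
  exact: le_trans (hit_time_le n w) rt.
rewrite Frc// => s /= ts; have s0 : 0 <= s by exact/ltW/(le_lt_trans t0 ts).
have [N HN] : exists N, forall n, r / 2 ^+ (N + n) <= s - t.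
  by apply: grid_mesh; rewrite ?subr_gt0.
have -> : \bigcap_n [set w | L n w <= t] = \bigcap_n [set w | L (N + n)%N w <= t].
  apply/seteqP; split => w /= H n _; first exact: H.
  apply: le_trans (H n Logic.I); apply: hit_time_homo; exact: leq_addl.
apply: sub_sigma_bigcap; first exact: subF.
move=> n; pose F k := if (k < 2 ^ (N + n))%N && (grid r (N + n) k <= t)
  then [set w | eps <= inc (N + n) k w] else set0.
have -> : [set w | L (N + n)%N w <= t] = \bigcup_k F k.
  apply/seteqP; split => w /=.
    move=> /(hit_timeP _ _ tr)[k [kn kt ek]]; exists k => //.
    by rewrite /F kn kt.
  rewrite /F => -[k _]; case: ifP => // /andP[kn kt] ek.
  by apply/(hit_timeP _ _ tr); exists k.
apply: sub_sigma_bigcup; first exact: subF.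
move=> k; rewrite /F; case: ifP => [/andP[kn kt]|_]; last exact: sub_sigma0 (subF s0).
have gs : grid r (N + n) k.+1 <= s.
  by rewrite gridS; have := HN n; lra.
apply: (Fmono _ _ (g0 (N + n) k.+1) gs).
by apply: measurable_wrt_ge (@measurable_increment _ _); exact: subF.
Qed.

Lemma measurable_hit_limit : measurable_fun setT hit_limit.
Proof.
apply: (measurability _ (ErealGenOInfty.measurableE R)) => //.
move=> _ [_ [x ->] <-]; rewrite setTI; have [S0 FS] := hit_limit_stopping.
have [x0|x0] := leP 0 x; last first.
  have -> : hit_limit @^-1` `]x%:E, +oo[%classic = setT.
    apply/seteqP; split => w //= _; rewrite in_itv/= andbT.
    by apply: lt_le_trans (S0 w); rewrite lte_fin.
  exact: measurableT.
have -> : hit_limit @^-1` `]x%:E, +oo[%classic = ~` [set w | (hit_limit w <= x%:E)%E].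
  by apply/seteqP; split => w /=; rewrite in_itv/= andbT ltNge => /negP.
by apply: measurableC; apply: (subF x0).2; exact: FS.
Qed.

Lemma measurable_eq_hit_limit : measurable [set w | tau w = hit_limit w].
Proof.
rewrite -[X in measurable X]setTI; apply: measurable_eqe => //.
exact: measurable_hit_limit.
Qed.

Definition first_hit_event n k := [set w | kappa n w = k /\ (k < 2 ^ n)%N].

Lemma first_hit_event_infty n k : Foo (first_hit_event n k).
Proof.
have Hge j : Foo [set w | eps <= inc n j w].
  by apply: measurable_wrt_ge => //; exact: measurable_increment_infty.
have [kn|nk] := ltnP k (2 ^ n)%N; last first.
  have := sub_sigma0 subFoo; congr Foo; apply/seteqP; split => w //= -[].
  by rewrite /first_hit_event/= ltnNge nk.
have -> : first_hit_event n k = [set w | eps <= inc n k w] `&`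
    \bigcap_j (if (j < k)%N then ~` [set w | eps <= inc n j w] else setT).
  apply/seteqP; split => w /=;
    have [le1 lt1 min1] := find_iota_spec (fun k => eps <= inc n k w) (2 ^ n);
    rewrite -/(kappa n w) in le1 lt1 min1.
    move=> [kE _]; rewrite kE in lt1 min1; split; first exact: lt1.
    move=> j _; case: ifP => // jk /= ej.
    by have := min1 _ (ltn_trans jk kn) ej; rewrite leqNgt jk.
  move=> [ek H]; split => //; apply/eqP; rewrite eqn_leq min1//= leqNgt.
  apply/negP => kk; have := H (kappa n w) Logic.I; rewrite kk /=; apply.
  by apply: lt1; exact: ltn_trans kn.
apply: (sub_sigmaI subFoo (Hge k)); apply: (sub_sigma_bigcap subFoo) => j.
case: ifP => _; last exact: sub_sigmaT subFoo.
exact: sub_sigmaC subFoo (Hge j).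
Qed.

Lemma hitE n : hit n = \bigcup_k first_hit_event n k.
Proof.
apply/seteqP; split => w /=; first by move=> h; exists (kappa n w).
by move=> [k _ [<-]].
Qed.

Lemma hit_infty n : Foo (hit n).
Proof.
rewrite hitE; apply: (sub_sigma_bigcup subFoo) => k; exact: first_hit_event_infty.
Qed.

Definition caught n := \bigcup_k (first_hit_event n k `&` I n k).

Lemma measurable_caught n : measurable (caught n).
Proof.
apply: bigcup_measurable => k _; apply: measurableI.
  by apply: subFoo.2; exact: first_hit_event_infty.
exact: measurable_interval_event.
Qed.

(** The first-hit events are in F_oo, so on each of them the mass of tau in that cell is the
    integral of the increment of A, which is there at least [eps]. *)
Lemma caught_ge n : (eps%:E * P (hit n) <= P (caught n))%E.
Proof.
have mH k : measurable (first_hit_event n k).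
  by apply: subFoo.2; exact: first_hit_event_infty.
have tH : trivIset setT (first_hit_event n).
  by move=> i j _ _ [w [[<- _] [<- _]]].
rewrite hitE measure_bigcup// /caught measure_bigcup//; last 2 first.
- by move=> k _; apply: measurableI => //; exact: measurable_interval_event.
- exact: trivIset_setIr.
rewrite -nneseriesZl//.
apply: lee_nneseries => [k _ _|k _]; first by rewrite mule_ge0// lee_fin ltW.
rewrite [leRHS](_ : _ = (\int[P]_(w in first_hit_event n k) (\1_(I n k) w)%:E)%E); last first.
  by rewrite integral_indic//; [rewrite setIC|exact: measurable_interval_event].
rewrite integral_increment; last exact: first_hit_event_infty.
rewrite -integral_cst//; apply: ge0_le_integral => //.
- by move=> w _; rewrite lee_fin ltW.
- apply: measurable_funTS; apply/measurable_EFinP.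
  exact: measurable_wrt_fun (@measurable_increment_infty n k).
move=> w [kE kn]; rewrite lee_fin.
by have [_ + _] := find_iota_spec (fun k => eps <= inc n k w) (2 ^ n);
  rewrite -/(kappa n w) kE; apply.
Qed.

(** Each catch gives L_n < tau <= L_n + mesh; along infinitely many n both bounds tend to the
    supremum of the L_n. *)
Lemma caught_limit w : (forall m, exists2 n, (m <= n)%N & caught n w) ->
  tau w = hit_limit w.
Proof.
have caughtP n : caught n w ->
    ((L n w)%:E < tau w)%E /\ (tau w <= (L n w + r / 2 ^+ n)%:E)%E.
  by move=> [k _ [[<- _] /andP[h1 h2]]]; split => //; rewrite /L -gridS.
move=> H; apply/eqP; rewrite eq_le; apply/andP; split.
  apply/lee_addgt0Pr => x x0; have [N HN] := grid_mesh r0 x0.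
  have [n Nn /caughtP[_ h]] := H N; apply: le_trans h _.
  rewrite EFinD; apply: leeD; first by apply: ereal_sup_ubound; exists n.
  by rewrite lee_fin -(subnKC Nn).
apply: ge_ereal_sup => _ [m _ <-].
have [n mn /caughtP[h _]] := H m; apply: ltW; apply: le_lt_trans h.
by rewrite lee_fin; exact: hit_time_homo.
Qed.

(** Otherwise each [caught n] has mass at least [eps * del], hence so does their upper limit, on
    which tau equals a stopping time. *)
Lemma hit_vanish (del : R) : 0 < del -> exists n, (P (hit n) < del%:E)%E.
Proof.
move=> del0; apply: contrapT => /forallNP H.
have Hn n : (del%:E <= P (hit n))%E by rewrite leNgt; apply/negP; exact: H.
pose F m := \bigcup_(n in [set n | (m <= n)%N]) caught n.
have mF m : measurable (F m).
  by apply: bigcup_measurable => n _; exact: measurable_caught.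
have PF m : ((eps * del)%:E <= P (F m))%E.
  apply: (@le_trans _ _ (P (caught m))).
    apply: le_trans (caught_ge m); rewrite EFinM lee_wpmul2l// lee_fin ltW//.
  apply: le_measure; rewrite ?inE//; first exact: measurable_caught.
  by move=> w cw; exists m => /=.
have cF : P (F m) @[m --> \oo] --> P (\bigcap_m F m).
  apply: nonincreasing_cvg_mu => //.
  - by rewrite (le_lt_trans (probability_le1 _ _))// ltry.
  - exact: bigcap_measurable.
  - move=> m n mn; apply/subsetPset => w [k nk cw]; exists k => //=.
    exact: leq_trans nk.
have : (P (\bigcap_m F m) <= P [set w | tau w = hit_limit w])%E.
  apply: le_measure; rewrite ?inE.
  - exact: bigcapT_measurable.
  - exact: measurable_eq_hit_limit.
  - move=> w Fw; apply: caught_limit => m; have [n mn cw] := Fw m Logic.I.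
    by exists n.
rewrite (A_tau hit_limit_stopping) => P0.
have : ((eps * del)%:E <= P (\bigcap_m F m))%E.
  rewrite -(cvg_lim _ cF)//; apply: lime_ge; first exact: cvgP cF.
  exact: nearW.
move=> /le_trans/(_ P0); rewrite lee_fin leNgt mulr_gt0//.
Qed.

End hit.

End no_jump.

(** * Oscillation of martingales at the random time *)

Section integral_rv.
Context d (T : measurableType d) (R : realType) (mu : {measure set T -> \bar R}).
Implicit Types X Y : T -> R.

Lemma integral_rv_ge0 X : (forall w, 0 <= X w) -> (0 <= \int[mu]_w (X w)%:E)%E.
Proof. by move=> X0; apply: integral_ge0 => w _; rewrite lee_fin. Qed.

Lemma integral_rvD X Y : measurable_fun setT X -> (forall w, 0 <= X w) ->
  measurable_fun setT Y -> (forall w, 0 <= Y w) ->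
  (\int[mu]_w (X w + Y w)%:E = \int[mu]_w (X w)%:E + \int[mu]_w (Y w)%:E)%E.
Proof.
move=> mX X0 mY Y0; rewrite -ge0_integralD//.
- by move=> w _; rewrite lee_fin.
- exact/measurable_EFinP.
- by move=> w _; rewrite lee_fin.
- exact/measurable_EFinP.
Qed.

Lemma integral_rvZ (c : R) X : 0 <= c -> measurable_fun setT X ->
  (forall w, 0 <= X w) ->
  (\int[mu]_w (c * X w)%:E = c%:E * \int[mu]_w (X w)%:E)%E.
Proof.
move=> c0 mX X0; rewrite -ge0_integralZl_EFin//.
- by move=> w _; rewrite lee_fin.
- exact/measurable_EFinP.
Qed.

Lemma integral_rv_le X Y : measurable_fun setT X -> (forall w, 0 <= X w) ->
  measurable_fun setT Y -> (forall w, X w <= Y w) ->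
  (\int[mu]_w (X w)%:E <= \int[mu]_w (Y w)%:E)%E.
Proof.
move=> mX X0 mY XY; apply: ge0_le_integral => //.
- by move=> w _; rewrite lee_fin.
- exact/measurable_EFinP.
- exact/measurable_EFinP.
- by move=> w _; rewrite lee_fin.
Qed.

Lemma integral_rv_sum (X : nat -> T -> R) N :
  (forall k, measurable_fun setT (X k)) -> (forall k w, 0 <= X k w) ->
  (\int[mu]_w (\sum_(k < N) X k w)%:E = \sum_(k < N) \int[mu]_w (X k w)%:E)%E.
Proof.
move=> mX X0; rewrite -[RHS]ge0_integral_sum//.
- by apply: eq_integral => w _; rewrite sumEFin.
- by move=> k; exact/measurable_EFinP.
- by move=> k w _; rewrite lee_fin.
Qed.

End integral_rv.

Section oscillation.
Context d (T : measurableType d) (R : realType).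
Variables (P : probability T R) (Ft : R -> set (set T)) (tau : T -> \bar R).
Hypotheses (usualF : usual_conditions P Ft) (rt_tau : random_time tau)
  (A_tau : avoids_stopping_times P Ft tau).
Variables (r : R) (A : nat -> nat -> T -> R).
Hypotheses (r0 : 0 < r) (HA : is_compensator P Ft tau r A).
Variables (B : set T) (a : R -> T -> R).
Hypothesis (aP : forall u, 0 <= u -> [/\ measurable_wrt (Ft u) (a u),
  (forall w, 0 <= a u w <= 1) & forall C, Ft u C ->
  (\int[P]_(w in C) (\1_B w)%:E = \int[P]_(w in C) (a u w)%:E)%E]).
Local Notation Foo := (sigma_infty Ft).
Local Notation inc := (increment A).
Local Notation I := (interval_event tau r).
Implicit Types (C D : set T) (s t u : R) (n k N : nat).

Let filF : filtration Ft. Proof. by case: usualF. Qed.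
Let subF t : 0 <= t -> sub_sigma (Ft t).
Proof. by move=> t0; apply: (filtration_sub filF). Qed.
Let subFoo : sub_sigma Foo. Proof. exact: sigma_infty_sub filF. Qed.
Let g0 n k : 0 <= grid r n k. Proof. exact: grid_ge0. Qed.
Let minc n k : measurable_fun setT (inc n k).
Proof.
exact: measurable_wrt_fun (@measurable_increment_infty _ _ _ _ _ _ usualF _ _ r0 HA n k).
Qed.
Let inc0 n k w : 0 <= inc n k w. Proof. exact: increment_ge0 HA _ _ _. Qed.

(** Without a hit at threshold [del / 2] the squares sum to at most [del / 2] times the total
    increment, itself at most 1; with a hit they sum to at most 1, and a hit has probability below
    [del / 2]. *)
Lemma sum_increment_sqr_vanish (del : R) : 0 < del ->
  exists n, (\int[P]_w (\sum_(k < 2 ^ n) inc n k w ^+ 2)%:E <= del%:E)%E.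
Proof.
move=> del0; have e0 : 0 < del / 2 by rewrite divr_gt0.
have [n Hn] := hit_vanish usualF rt_tau A_tau r0 HA e0 e0.
exists n; pose H := hit A (del / 2) n.
have mH : measurable H.
  by apply: subFoo.2; exact: (@hit_infty _ _ _ _ _ _ usualF _ _ r0 HA).
apply: (@le_trans _ _ (\int[P]_w (del / 2 + \1_H w)%:E)%E).
  apply: integral_rv_le.
  - by apply: measurable_sum => k; exact: measurable_funX.
  - by move=> w; apply: sumr_ge0 => k _; exact: sqr_ge0.
  - apply: measurable_funD; [exact: measurable_cst|exact: measurable_indic].
  - move=> w; rewrite indicE; case: (boolP (w \in H)) => wH.
      apply: (@le_trans _ _ 1); last by rewrite lerDr ltW.
      apply: le_trans (sum_increment HA n (2 ^ n) w); apply: ler_sum => k _.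
      by rewrite expr2 ler_piMr//; exact: increment_le1 HA _ _ _.
    rewrite addr0; have {}wH k : (k < 2 ^ n)%N -> inc n k w <= del / 2.
      move=> kn; rewrite leNgt; apply/negP => /ltW ek; move/negP: wH; apply.
      rewrite inE /H/hit/=.
      have [_ _ min1] := find_iota_spec (fun k => del / 2 <= inc n k w) (2 ^ n).
      exact: leq_ltn_trans (min1 _ kn ek) kn.
    apply: (@le_trans _ _ (\sum_(k < 2 ^ n) del / 2 * inc n k w)).
      by apply: ler_sum => k _; rewrite expr2 ler_wpM2r// wH.
    by rewrite -mulr_sumr; apply: ler_piMr; [exact: ltW|exact: sum_increment HA _ _ _].
rewrite integral_rvD//; last by move=> w; exact: ltW.
have PT : (P : {measure set T -> \bar R}) setT = 1%E by exact: probability_setT.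
rewrite integral_cst// PT mule1 integral_indic// setIT.
rewrite [leRHS](_ : _ = (del / 2)%:E + (del / 2)%:E)%E; last first.
  by rewrite -EFinD -splitr.
by apply: leeD => //; exact: ltW.
Qed.

Definition step n k w := `|a (grid r n k.+1) w - a (grid r n k) w|.

Let ma n k : measurable_fun setT (a (grid r n k)).
Proof. by have [m _ _] := aP (g0 n k); apply: measurable_wrt_fun m; exact: subF. Qed.
Let a01 n k w : 0 <= a (grid r n k) w <= 1.
Proof. by have [] := aP (g0 n k). Qed.
Let a_ge0 n k w : 0 <= a (grid r n k) w. Proof. by case/andP: (a01 n k w). Qed.

Lemma step_ge0 n k w : 0 <= step n k w. Proof. exact: normr_ge0. Qed.

Lemma step_le1 n k w : step n k w <= 1.
Proof.
rewrite /step ler_norml; have /andP[] := a01 n k w; have /andP[] := a01 n k.+1 w.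
by move=> *; lra.
Qed.

Lemma measurable_step_infty n k : measurable_wrt Foo (step n k).
Proof.
have mFoo j : measurable_wrt Foo (a (grid r n j)).
  have [m _ _] := aP (g0 n j); apply: measurable_wrt_le m.
  exact: filtration_sigma_infty.
apply: (@measurable_wrt_comp _ _ _ _ _ (fun x : R => `|x|)) => //.
exact: measurable_wrtB.
Qed.

Lemma measurable_step n k : measurable_fun setT (step n k).
Proof. exact: measurable_wrt_fun (@measurable_step_infty n k). Qed.

(** Orthogonality of martingale increments, stated as a sum because the integrals are extended
    reals. *)
Lemma integral_step_sqr n k :
  (\int[P]_w (step n k w ^+ 2)%:E + \int[P]_w (a (grid r n k) w ^+ 2)%:E =
   \int[P]_w (a (grid r n k.+1) w ^+ 2)%:E)%E.
Proof.
have [m1 _ E1] := aP (g0 n k); have [_ _ E2] := aP (g0 n k.+1).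
have [_ _ Fmono] := filF.
have TO : (\int[P]_w (a (grid r n k) w * a (grid r n k.+1) w)%:E =
           \int[P]_w (a (grid r n k) w * a (grid r n k) w)%:E)%E.
  apply: (take_out (subF (g0 n k))) => // C FC; rewrite -E1// -E2//.
  by apply: Fmono FC => //; exact: grid_le.
have fin : (\int[P]_w (a (grid r n k) w ^+ 2)%:E \is a fin_num)%E.
  rewrite ge0_fin_numE; last by apply: integral_rv_ge0 => w; exact: sqr_ge0.
  apply: (@le_lt_trans _ _ 1%E); last by rewrite ltry.
  apply: integral_le1_lty => //; first exact: measurable_funX.
  by move=> w; rewrite sqr_ge0/= exprn_ile1//; case/andP: (a01 n k w).
apply: (fin_num_addeI fin).
have q0 j w : 0 <= a (grid r n j) w ^+ 2 by exact: sqr_ge0.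
have mq j : measurable_fun setT (fun w => a (grid r n j) w ^+ 2).
  exact: measurable_funX.
rewrite -[RHS]integral_rvD//.
have -> : (\int[P]_w (a (grid r n k) w ^+ 2 + a (grid r n k.+1) w ^+ 2)%:E =
  \int[P]_w (step n k w ^+ 2 + (a (grid r n k) w * a (grid r n k.+1) w +
     a (grid r n k) w * a (grid r n k.+1) w))%:E)%E.
  apply: eq_integral => w _; congr (_%:E).
  by rewrite /step -normrX ger0_norm ?sqr_ge0//; ring.
have p0 w : 0 <= a (grid r n k) w * a (grid r n k.+1) w by exact: mulr_ge0.
have mp : measurable_fun setT (fun w => a (grid r n k) w * a (grid r n k.+1) w).
  exact: measurable_funM.
rewrite integral_rvD//; last 4 first.
- by apply: measurable_funX; exact: measurable_step.
- by move=> w; exact: sqr_ge0.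
- exact: measurable_funD.
- by move=> w; rewrite addr_ge0.
rewrite integral_rvD// TO.
by under eq_integral do rewrite expr2; rewrite addeCA.
Qed.

Lemma sum_step_sqr n N : (\int[P]_w (\sum_(k < N) step n k w ^+ 2)%:E <= 1)%E.
Proof.
have ms k : measurable_fun setT (fun w => step n k w ^+ 2).
  by apply: measurable_funX; exact: measurable_step.
have s0 k w : 0 <= step n k w ^+ 2 by exact: sqr_ge0.
have H : (\int[P]_w (\sum_(k < N) step n k w ^+ 2)%:E +
    \int[P]_w (a (grid r n 0) w ^+ 2)%:E = \int[P]_w (a (grid r n N) w ^+ 2)%:E)%E.
  rewrite (@integral_rv_sum _ _ _ P (fun k w => step n k w ^+ 2) N)//.
  elim: N => [|N IH]; first by rewrite big_ord0 add0e.
  rewrite big_ord_recr/= -addeA (addeC (\int[P]_w (step n N w ^+ 2)%:E)%E) addeA.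
  by rewrite IH addeC integral_step_sqr.
apply: (@le_trans _ _ (\int[P]_w (a (grid r n N) w ^+ 2)%:E)%E).
  by rewrite -H leeDl// integral_rv_ge0// => w; exact: sqr_ge0.
apply: integral_le1_lty => //; first exact: measurable_funX.
by move=> w; rewrite sqr_ge0/= exprn_ile1//; case/andP: (a01 n N w).
Qed.

(** The cells being disjoint, at most one term survives: the increment of a over the cell containing
    tau, in absolute value, and 0 when tau is outside ]0, r]. *)
Definition oscillation n w := \sum_(k < 2 ^ n) step n k w * \1_(I n k) w.

Let mI n k : measurable (I n k). Proof. exact: measurable_interval_event. Qed.

Lemma sum_indic_interval n N w : \sum_(k < N) (\1_(I n k) w : R) =
  \1_[set w | (tau w <= (grid r n N)%:E)%E] w - \1_[set w | (tau w <= 0)%E] w.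
Proof.
under eq_bigr do rewrite indic_interval//.
rewrite -(big_mkord xpredT (fun k =>
  \1_[set w | (tau w <= (grid r n k.+1)%:E)%E] w -
  \1_[set w | (tau w <= (grid r n k)%:E)%E] w)) telescope_sumr//.
by rewrite grid0.
Qed.

Lemma measurable_oscillation n : measurable_fun setT (oscillation n).
Proof.
by apply: measurable_sum => k; apply: measurable_funM => //; exact: measurable_step.
Qed.

Lemma oscillation01 n w : 0 <= oscillation n w <= 1.
Proof.
have i0 k : 0 <= \1_(I n k) w :> R by [].
rewrite sumr_ge0/=; last by move=> k _; rewrite mulr_ge0// step_ge0.
apply: (@le_trans _ _ (\sum_(k < 2 ^ n) (\1_(I n k) w : R))).
  by apply: ler_sum => k _; rewrite ler_piMl// step_le1.
rewrite sum_indic_interval !indicE.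
by case: (_ \in _); case: (_ \in _); rewrite ?subrr ?subr0 ?sub0r// lerN10.
Qed.

Lemma oscillation_vanish (del : R) : 0 < del ->
  exists n, (\int[P]_w (oscillation n w)%:E <= del%:E)%E.
Proof.
(* With the bound [lam * lam] on the squared increments of A and 1 on those of a, the final estimate
   is [lam * 1 + lam^-1 * (lam * lam)], which is [del]. *)
move=> del0; pose lam := del / 2; have lam0 : 0 < lam by rewrite divr_gt0.
have [n Hn] := sum_increment_sqr_vanish (mulr_gt0 lam0 lam0).
exists n.
have ms k := @measurable_step n k; have s0 k w := step_ge0 n k w.
have m2 k : measurable_fun setT (fun w => step n k w ^+ 2) by exact: measurable_funX.
have mi2 k : measurable_fun setT (fun w => inc n k w ^+ 2) by exact: measurable_funX.
(* [step] is F_oo-measurable, so the indicator of the cell may be replaced by its conditional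
   expectation on F_oo, the increment of A. *)
have TO k : (\int[P]_w (step n k w * \1_(I n k) w)%:E =
    \int[P]_w (step n k w * inc n k w)%:E)%E.
  apply: (take_out subFoo) => // [C FC|]; last exact: measurable_step_infty.
  exact: (integral_increment usualF).
have -> : (\int[P]_w (oscillation n w)%:E =
    \int[P]_w (\sum_(k < 2 ^ n) step n k w * inc n k w)%:E)%E.
  rewrite (@integral_rv_sum _ _ _ P (fun k w => step n k w * \1_(I n k) w)); last 2 first.
  - by move=> k; exact: measurable_funM.
  - by move=> k w; rewrite mulr_ge0.
  rewrite (@integral_rv_sum _ _ _ P (fun k w => step n k w * inc n k w)); last 2 first.
  - by move=> k; exact: measurable_funM.
  - by move=> k w; rewrite mulr_ge0.
  by apply: eq_bigr => k _; exact: TO.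
(* AM-GM, weighted by lam *)
apply: (@le_trans _ _ (\int[P]_w (lam * (\sum_(k < 2 ^ n) step n k w ^+ 2) +
    lam^-1 * (\sum_(k < 2 ^ n) inc n k w ^+ 2))%:E)%E).
  apply: integral_rv_le.
  - by apply: measurable_sum => k; exact: measurable_funM.
  - by move=> w; apply: sumr_ge0 => k _; rewrite mulr_ge0.
  - apply: measurable_funD; apply: measurable_funM => //; exact: measurable_sum.
  - move=> w; rewrite !mulr_sumr -big_split/=; apply: ler_sum => k _.
    set x := step n k w; set y := inc n k w.
    have x0 : 0 <= x by exact: s0.
    have y0 : 0 <= y by exact: inc0.
    have -> : lam * x ^+ 2 + lam^-1 * y ^+ 2 =
        lam^-1 * ((lam * x - y) ^+ 2) + 2 * (x * y).
      by field; rewrite gt_eqF.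
    have h1 : 0 <= lam^-1 * (lam * x - y) ^+ 2.
      by rewrite mulr_ge0 ?sqr_ge0// invr_ge0 ltW.
    by have h2 : 0 <= x * y by [exact: mulr_ge0]; lra.
have sq0 (f : nat -> T -> R) w : 0 <= \sum_(k < 2 ^ n) f k w ^+ 2.
  by apply: sumr_ge0 => k _; exact: sqr_ge0.
have li0 : 0 <= lam^-1 by rewrite invr_ge0 ltW.
rewrite integral_rvD; last 4 first.
- by apply: measurable_funM => //; exact: measurable_sum.
- by move=> w; apply: mulr_ge0; [exact: ltW|exact: (sq0 (step n))].
- by apply: measurable_funM => //; exact: measurable_sum.
- by move=> w; apply: mulr_ge0; [exact: li0|exact: (sq0 (inc n))].
rewrite integral_rvZ; [|exact: ltW|exact: measurable_sum|exact: (sq0 (step n))].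
rewrite integral_rvZ; [|exact: li0|exact: measurable_sum|exact: (sq0 (inc n))].
have -> : del%:E = (lam%:E * 1 + lam^-1%:E * (lam * lam)%:E)%E.
  by rewrite mule1 -EFinM -EFinD mulKf ?gt_eqF// -splitr.
apply: leeD; apply: lee_wpmul2l.
- by rewrite lee_fin ltW.
- exact: sum_step_sqr.
- by rewrite lee_fin.
- exact: Hn.
Qed.

(** Split according to g <= K or g > K: the oscillation is at most 1, so the second part is bounded
    by the tail of an integrable variable. *)
Lemma oscillation_vanish_integrable (g : T -> R) (del : R) : measurable_fun setT g ->
  (forall w, 0 <= g w) -> (\int[P]_w (g w)%:E < +oo)%E -> 0 < del ->
  exists n, (\int[P]_w (g w * oscillation n w)%:E <= del%:E)%E.
Proof.
move=> mg gg0 ig del0; have d20 : 0 < del / 2 by rewrite divr_gt0.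
have tail := integral_tail_cvg0 mg gg0 ig.
have [K HK] : exists K : nat,
    (\int[P]_w (g w * \1_[set w | (K%:R < g w)%R] w)%:E <= (del / 2)%:E)%E.
  apply: contrapT => /forallNP H.
  have : ((del / 2)%:E <= 0)%E; last by rewrite lee_fin leNgt d20.
  rewrite -(cvg_lim _ tail)//; apply: lime_ge; first exact: cvgP tail.
  by apply: nearW => n; apply/ltW; rewrite ltNge; apply/negP; exact: H.
(* K + 1 in place of K, to divide by a positive number. *)
have K1 : 0 < K.+1%:R :> R by [].
have [n Hn] := oscillation_vanish (divr_gt0 d20 K1).
exists n.
have mC : measurable [set w | (K%:R < g w)%R].
  have -> : [set w | (K%:R < g w)%R] = setT `&` g @^-1` `]K%:R, +oo[.
    by rewrite setTI; apply/seteqP; split => w /=; rewrite in_itv/= andbT.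
  exact: mg.
have mi : measurable_fun setT (\1_[set w | (K%:R < g w)%R] : T -> R).
  exact: measurable_indic.
have mo := @measurable_oscillation n.
have o0 w : 0 <= oscillation n w by case/andP: (oscillation01 n w).
have o1 w : oscillation n w <= 1 by case/andP: (oscillation01 n w).
apply: (@le_trans _ _ (\int[P]_w (K.+1%:R * oscillation n w +
    g w * \1_[set w | (K%:R < g w)%R] w)%:E)%E).
  apply: integral_rv_le.
  - exact: measurable_funM.
  - by move=> w; rewrite mulr_ge0.
  - by apply: measurable_funD; apply: measurable_funM.
  - move=> w; rewrite indicE; case: (boolP (w \in _)) => wC.
      by rewrite mulr1; apply: ler_wpDl; [rewrite mulr_ge0|rewrite ler_piMr].
    rewrite mulr0 addr0 ler_wpM2r//.
    apply: (@le_trans _ _ K%:R); last by rewrite ler_nat.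
    by rewrite leNgt; apply/negP => Kg; move/negP: wC; apply; rewrite inE.
rewrite integral_rvD.
- rewrite integral_rvZ//.
  have -> : del%:E = (K.+1%:R%:E * (del / 2 / K.+1%:R)%:E + (del / 2)%:E)%E.
    by rewrite -EFinM -EFinD mulrC divfK ?gt_eqF// -splitr.
  by apply: leeD => //; apply: lee_wpmul2l => //; rewrite lee_fin.
- exact: measurable_funM.
- by move=> w; rewrite mulr_ge0.
- exact: measurable_funM.
- by move=> w; rewrite mulr_ge0.
Qed.

End oscillation.

(** * Densities determined by the sigma-algebra at tau *)

Section determination.
Context d (T : measurableType d) (R : realType).
Variables (P : probability T R) (Ft : R -> set (set T)) (tau : T -> \bar R).
Hypotheses (usualF : usual_conditions P Ft) (rt_tau : random_time tau)
  (A_tau : avoids_stopping_times P Ft tau)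
  (immP : immersed P Ft (progressive_enlargement Ft tau)).
Local Notation Gt := (progressive_enlargement Ft tau).
Local Notation Foo := (sigma_infty Ft).
Local Notation Goo := (sigma_infty Gt).
Implicit Types (B C D : set T) (s t u r : R) (h X : T -> R).

Let filF : filtration Ft. Proof. by case: usualF. Qed.
Let mtau : measurable_fun setT tau. Proof. by case: rt_tau. Qed.
Let subF t : 0 <= t -> sub_sigma (Ft t).
Proof. by move=> t0; apply: (filtration_sub filF). Qed.
Let subG t : 0 <= t -> sub_sigma (Gt t).
Proof. by move=> t0; apply: (enlargement_sub usualF rt_tau). Qed.
Let subFoo : sub_sigma Foo. Proof. exact: sigma_infty_sub filF. Qed.
Let subAt : sub_sigma (sigma_at Ft tau).
Proof. exact: sub_sigma_at usualF rt_tau A_tau. Qed.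
Let mtaule t : measurable [set w | (tau w <= t%:E)%E].
Proof. exact: measurable_tau_le. Qed.

(* Restricting to events before t, where tau is known, makes the property
   available for every sigma_at-measurable h, normalised or not. *)
Definition immersion_density h := forall t C, 0 <= t -> Gt t C ->
  C `<=` [set w | (tau w <= t%:E)%E] ->
  exists b, [/\ measurable_wrt (Ft t) b, (forall w, 0 <= b w) &
    forall D, Foo D -> (\int[P]_(w in D) (\1_C w * h w)%:E =
                        \int[P]_(w in D) (b w)%:E)%E].

(** Meant for X = a_(t_k) and s = t_k: the prediction at the beginning of the cell is known at
    tau. *)
Lemma measurable_wrt_sigma_at_interval s t X : 0 <= s -> measurable_wrt (Ft s) X ->
  measurable_wrt (sigma_at Ft tau)
    (fun w => X w * \1_[set w | (s%:E < tau w <= t%:E)%E] w).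
Proof.
move=> s0 mX _ [V mV <-]; rewrite setTI; set J := [set w | _].
have SI C : Ft s C -> sigma_at Ft tau (C `&` J).
  by move=> FC; exact: (sigma_at_interval usualF rt_tau A_tau).
have -> : (fun w => X w * \1_J w) @^-1` V =
    (X @^-1` V `&` J) `|` (~` J `&` [set _ | V 0]).
  apply/seteqP; split => w /=; rewrite indicE.
    by case: (boolP (w \in J)) => [/set_mem Jw|/negP wJ];
      rewrite ?mulr1 ?mulr0 => Vw; [left|right; split => // /mem_set].
  case=> [[Vw Jw]|[nJ V0]]; first by rewrite mem_set// mulr1.
  by rewrite memNset// mulr0.
have SJ : sigma_at Ft tau J by rewrite -[J]setTI; apply: SI; exact: sub_sigmaT (subF s0).
apply: (sub_sigmaU subAt).
  by apply: SI; apply: mX; exists V => //; rewrite setTI.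
apply: (sub_sigmaI subAt (sub_sigmaC subAt SJ)).
have [V0|V0] := pselect (V 0).
  by have := sub_sigmaT subAt; congr (sigma_at Ft tau); apply/seteqP; split.
by have := sub_sigma0 subAt; congr (sigma_at Ft tau); apply/seteqP; split.
Qed.

Section truncated.
Variables (r : R) (A : nat -> nat -> T -> R).
Hypotheses (r0 : 0 < r) (HA : is_compensator P Ft tau r A).
Variables (B : set T) (a : R -> T -> R).
Hypothesis FB : Foo B.
Hypothesis aP : forall u, 0 <= u -> [/\ measurable_wrt (Ft u) (a u),
  (forall w, 0 <= a u w <= 1) & forall C, Ft u C ->
  (\int[P]_(w in C) (\1_B w)%:E = \int[P]_(w in C) (a u w)%:E)%E].
Local Notation I := (interval_event tau r).
Local Notation stp := (step r a).
Let g0 n k : 0 <= grid r n k. Proof. exact: grid_ge0. Qed.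
Let mI n k : measurable (I n k). Proof. exact: measurable_interval_event. Qed.
Let ma n k : measurable_fun setT (a (grid r n k)).
Proof. by have [m _ _] := aP (g0 n k); apply: measurable_wrt_fun m; exact: subF. Qed.
Let a_ge0 n k w : 0 <= a (grid r n k) w.
Proof. by have [_ /(_ w)/andP[]] := aP (g0 n k). Qed.
Let mB : measurable B. Proof. exact: subFoo.2. Qed.
Let mindB : measurable_fun setT (\1_B : T -> R).
Proof. exact: measurable_indic. Qed.
Let mstp n k : measurable_fun setT (stp n k).
Proof. exact: (measurable_step usualF r0 aP). Qed.
Let stp0 n k w : 0 <= stp n k w. Proof. exact: step_ge0. Qed.

(** The mass that h gives to B and {0 < tau <= r}; the difference is the form to which the
    indicators of the cells telescope. *)
Definition truncated_mass h := (\int[P]_w (\1_B w *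
  (\1_[set w | (tau w <= r%:E)%E] w - \1_[set w | (tau w <= 0)%E] w) * h w)%:E)%E.

(** A cell I ending at u is in G_u, so E[1_I h | F_oo] has an F_u-measurable version b. Against b
    the indicator of B may be replaced by its prediction a_u, and b is then traded back for 1_I
    h. *)
Lemma truncated_massE h n : measurable_fun setT h -> (forall w, 0 <= h w) ->
  immersion_density h ->
  truncated_mass h = (\sum_(k < 2 ^ n)
    \int[P]_w (a (grid r n k.+1) w * (\1_(I n k) w * h w))%:E)%E.
Proof.
move=> mh h0 Hh.
have ih0 k w : 0 <= \1_(I n k) w * h w by exact: mulr_ge0.
have mih k : measurable_fun setT (fun w => \1_(I n k) w * h w) by exact: measurable_funM.
transitivity (\int[P]_w (\sum_(k < 2 ^ n) \1_B w * (\1_(I n k) w * h w))%:E)%E.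
  apply: eq_integral => w _; congr (_%:E).
  have := sum_indic_interval tau r0 n (2 ^ n) w; rewrite grid_top => <-.
  by rewrite -mulr_sumr -mulr_suml mulrA.
rewrite (@integral_rv_sum _ _ _ P (fun k w => \1_B w * (\1_(I n k) w * h w))); last 2 first.
- by move=> k; exact: measurable_funM.
- by move=> k w; rewrite mulr_ge0.
apply: eq_bigr => k _.
have GI : Gt (grid r n k.+1) (I n k).
  rewrite interval_eventE; apply: (sub_sigmaD (subG (g0 n k.+1))).
    exact: enlargement_le.
  by apply: enlargement_le; exact: grid_le.
have Itau : I n k `<=` [set w | (tau w <= (grid r n k.+1)%:E)%E].
  by move=> w /andP[].
have [b [mb b0 bE]] := Hh _ _ (g0 n k.+1) GI Itau.
have [m1 _ E1] := aP (g0 n k.+1).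
have mb' : measurable_fun setT b by apply: measurable_wrt_fun mb; exact: subF.
rewrite -(integral_indicM P B (fun w => \1_(I n k) w * h w)) bE// integral_indicM.
under eq_integral do rewrite mulrC.
rewrite (take_out (subF (g0 n k.+1)) mindB _ (ma n k.+1) _ E1 mb b0)//.
under eq_integral do rewrite mulrC.
apply: (take_out subFoo) => //; first by move=> C FC; rewrite bE.
by apply: measurable_wrt_le m1; exact: filtration_sigma_infty.
Qed.

(** Moving the prediction from the end of each cell to its beginning costs the oscillation weighted
    by h1; there h1 and h2 give the same mass; moving back costs the oscillation weighted by h2. One
    inequality suffices, as h1 and h2 can be exchanged. *)
Lemma truncated_mass_le h1 h2 (del : R) :
  measurable_fun setT h1 -> (forall w, 0 <= h1 w) -> (\int[P]_w (h1 w)%:E < +oo)%E ->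
  measurable_fun setT h2 -> (forall w, 0 <= h2 w) -> (\int[P]_w (h2 w)%:E < +oo)%E ->
  immersion_density h1 -> immersion_density h2 ->
  (forall C, sigma_at Ft tau C ->
    (\int[P]_(w in C) (h1 w)%:E = \int[P]_(w in C) (h2 w)%:E)%E) ->
  0 < del -> (truncated_mass h1 <= truncated_mass h2 + del%:E)%E.
Proof.
move=> mh1 h10 ih1 mh2 h20 ih2 H1 H2 h12 del0.
have mh : measurable_fun setT (fun w => h1 w + h2 w) by exact: measurable_funD.
have hh0 w : 0 <= h1 w + h2 w by rewrite addr_ge0.
have ih : (\int[P]_w (h1 w + h2 w)%:E < +oo)%E.
  by rewrite integral_rvD// lte_add_pinfty.
(* The grid is chosen for the weight h1 + h2, which covers both costs at once. *)
have [n Hn] := oscillation_vanish_integrable usualF rt_tau A_tau r0 HA aP mh hh0 ih del0.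
rewrite (truncated_massE n mh1 h10 H1) (truncated_massE n mh2 h20 H2).
have i0 k w : 0 <= \1_(I n k) w :> R by [].
have agree k : (\int[P]_w (a (grid r n k) w * (\1_(I n k) w * h1 w))%:E =
    \int[P]_w (a (grid r n k) w * (\1_(I n k) w * h2 w))%:E)%E.
  under eq_integral do rewrite mulrA.
  under [RHS]eq_integral do rewrite mulrA.
  have [m1 _ _] := aP (g0 n k).
  apply: (take_out subAt) => //; first exact: measurable_wrt_sigma_at_interval.
  by move=> w; rewrite mulr_ge0.
have le1 h k x y : measurable_fun setT h -> (forall w, 0 <= h w) ->
    (forall w, x w <= y w + stp n k w) -> measurable_fun setT x ->
    measurable_fun setT y -> (forall w, 0 <= x w) -> (forall w, 0 <= y w) ->
    (\int[P]_w (x w * (\1_(I n k) w * h w))%:E <=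
     \int[P]_w (y w * (\1_(I n k) w * h w))%:E +
     \int[P]_w (stp n k w * (\1_(I n k) w * h w))%:E)%E.
  move=> mh' h0 xy mx my x0 y0.
  have ih0 w : 0 <= \1_(I n k) w * h w by exact: mulr_ge0.
  have mih : measurable_fun setT (fun w => \1_(I n k) w * h w) by exact: measurable_funM.
  rewrite -integral_rvD; first 1 last.
  - exact: measurable_funM.
  - by move=> w; rewrite mulr_ge0.
  - exact: measurable_funM.
  - by move=> w; rewrite mulr_ge0.
  apply: integral_rv_le.
  - exact: measurable_funM.
  - by move=> w; rewrite mulr_ge0.
  - by apply: measurable_funD; exact: measurable_funM.
  - by move=> w; rewrite -mulrDl ler_wpM2r.
have key k : (\int[P]_w (a (grid r n k.+1) w * (\1_(I n k) w * h1 w))%:E <=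
    \int[P]_w (a (grid r n k.+1) w * (\1_(I n k) w * h2 w))%:E +
    \int[P]_w (stp n k w * \1_(I n k) w * (h1 w + h2 w))%:E)%E.
  have -> : (\int[P]_w (stp n k w * \1_(I n k) w * (h1 w + h2 w))%:E =
      \int[P]_w (stp n k w * (\1_(I n k) w * h2 w))%:E +
      \int[P]_w (stp n k w * (\1_(I n k) w * h1 w))%:E)%E.
    rewrite -integral_rvD; first 1 last.
    - by apply: measurable_funM => //; exact: measurable_funM.
    - by move=> w; rewrite !mulr_ge0.
    - by apply: measurable_funM => //; exact: measurable_funM.
    - by move=> w; rewrite !mulr_ge0.
    by apply: eq_integral => w _; congr (_%:E); ring.
  rewrite addeA; apply: le_trans (_ : _ <= \int[P]_w (a (grid r n k) w * (\1_(I n k) w * h1 w))%:E +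
      \int[P]_w (stp n k w * (\1_(I n k) w * h1 w))%:E)%E _.
    by apply: le1 => // w; rewrite /step -lerBlDl ler_norm.
  apply: leeD => //; rewrite agree; apply: le1 => // w.
  by rewrite /step distrC -lerBlDl ler_norm.
apply: (@le_trans _ _ (\sum_(k < 2 ^ n)
    (\int[P]_w (a (grid r n k.+1) w * (\1_(I n k) w * h2 w))%:E +
    \int[P]_w (stp n k w * \1_(I n k) w * (h1 w + h2 w))%:E))%E).
  by apply: lee_sum => k _; exact: key.
rewrite big_split/=; apply: leeD => //.
rewrite -(@integral_rv_sum _ _ _ P (fun k w => stp n k w * \1_(I n k) w * (h1 w + h2 w))).
- apply: le_trans Hn; rewrite le_eqVlt; apply/orP; left; apply/eqP.
  apply: eq_integral => w _; congr (_%:E).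
  by rewrite mulrC /oscillation mulr_suml.
- by move=> k; apply: measurable_funM => //; exact: measurable_funM.
- by move=> k w; rewrite !mulr_ge0.
Qed.

End truncated.

Lemma immersion_density_determined h1 h2 :
  measurable_fun setT h1 -> (forall w, 0 <= h1 w) -> (\int[P]_w (h1 w)%:E < +oo)%E ->
  measurable_fun setT h2 -> (forall w, 0 <= h2 w) -> (\int[P]_w (h2 w)%:E < +oo)%E ->
  immersion_density h1 -> immersion_density h2 ->
  (forall C, sigma_at Ft tau C ->
    (\int[P]_(w in C) (h1 w)%:E = \int[P]_(w in C) (h2 w)%:E)%E) ->
  forall C, Goo C -> (\int[P]_(w in C) (h1 w)%:E = \int[P]_(w in C) (h2 w)%:E)%E.
Proof.
move=> mh1 h10 ih1 mh2 h20 ih2 H1 H2 h12.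
(* The cells start after time 0, so {tau = 0} is lost; tau avoids the constant time 0. *)
have null0 : P [set w | (tau w <= 0)%E] = 0%E.
  rewrite (_ : [set w | (tau w <= 0)%E] = [set w | tau w = 0%E]).
    exact: avoids_cst usualF A_tau _ (lexx 0%E).
  apply/seteqP; split => w /=; last by move=> ->.
  by move=> t0; apply/eqP; rewrite eq_le t0; case: rt_tau => _ ->.
have rect r B : 0 <= r -> Foo B ->
    (\int[P]_(w in B `&` [set w | (tau w <= r%:E)%E]) (h1 w)%:E =
     \int[P]_(w in B `&` [set w | (tau w <= r%:E)%E]) (h2 w)%:E)%E.
  move=> r0 FB; have mB := subFoo.2 _ FB.
  have tm h : measurable_fun setT h -> (forall w, 0 <= h w) ->
      (\int[P]_(w in B `&` [set w | (tau w <= r%:E)%E]) (h w)%:E =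
       truncated_mass r B h)%E.
    move=> mh h0; rewrite integral_indicM /truncated_mass.
    have le01 w : 0 <= \1_[set w | (tau w <= r%:E)%E] w -
        \1_[set w | (tau w <= 0)%E] w :> R.
      rewrite subr_ge0 !indicE; case: (boolP (w \in [set w | (tau w <= 0)%E])) => // /set_mem t0.
      by rewrite mem_set//=; apply: le_trans t0 _; rewrite lee_fin.
    apply: ge0_ae_eq_integral => //.
    - apply/measurable_EFinP; apply: measurable_funM => //.
      by apply: measurable_indic; exact: measurableI.
    - apply/measurable_EFinP; apply: measurable_funM => //.
      apply: measurable_funM; first exact: measurable_indic.
      by apply: measurable_funB; apply: measurable_indic; [exact: mtaule|exact: (mtaule 0)].
    - by move=> w _; rewrite lee_fin mulr_ge0.
    - by move=> w _; rewrite lee_fin !mulr_ge0.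
    - exists [set w | (tau w <= 0)%E]; split; [exact: (mtaule 0)|exact: null0|].
      move=> w /=; apply: contra_notP => t0 _; congr (_%:E).
      have z0 : \1_[set w | (tau w <= 0)%E] w = 0 :> R by rewrite indicE memNset.
      by rewrite z0 subr0 indicI.
  (* The grids need r > 0; for r = 0 the event is null. *)
  move: r0; rewrite le_eqVlt => /predU1P[r0|r0].
    have mBr : measurable (B `&` [set w | (tau w <= r%:E)%E]) by exact: measurableI.
    have PBr : P (B `&` [set w | (tau w <= r%:E)%E]) = 0%E.
      apply: (@subset_measure0 _ _ _ P _ [set w | (tau w <= 0)%E]) => //; first exact: mtaule.
      by move=> w [_ /=]; rewrite -r0.
    by rewrite !null_set_integral//; apply: measurable_funTS; apply/measurable_EFinP.
  rewrite !tm//.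
  have [A HA] := compensator_exists usualF rt_tau immP r0.
  have mi : measurable_fun setT (\1_B : T -> R) by exact: measurable_indic.
  have i01 w : 0 <= (\1_B w : R) <= 1.
    by rewrite indicE; case: (_ \in _); rewrite ?lexx ler01.
  have aex u : exists a : T -> R, 0 <= u -> [/\ measurable_wrt (Ft u) a,
      (forall w, 0 <= a w <= 1) & forall C, Ft u C ->
      (\int[P]_(w in C) (\1_B w)%:E = \int[P]_(w in C) (a w)%:E)%E].
    have [u0|u0] := leP 0 u; last by exists (cst 0).
    by have [a Ha] := cond_exp_exists01 P (subF u0) mi i01; exists a.
  have [a aP] := choice aex.
  apply/eqP; rewrite eq_le; apply/andP; split; apply/lee_addgt0Pr => x x0.
    exact: (truncated_mass_le r0 HA FB aP).
  by apply: (truncated_mass_le r0 HA FB aP) => // C SC; rewrite h12.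
have total : (\int[P]_w (h1 w)%:E = \int[P]_w (h2 w)%:E)%E.
  by apply: h12; exact: sub_sigmaT.
move=> C /(sigma_infty_rectangles usualF rt_tau).
apply: (eq_integral_generated (time_rectangles_measurable usualF rt_tau)
  (@time_rectanglesI _ _ _ _ _ _ usualF)) => // D [s s0 [B FB [->|[r r0 ->]]]]; last first.
  by apply: rect => //; exact: (filtration_sigma_infty s0).
have mB : measurable B by exact: (subF s0).2.
have mBt n : measurable (B `&` [set w | (tau w <= n%:R%:E)%E]) by exact: measurableI.
have moo : measurable [set w | tau w = +oo%E].
  by have := mtau measurableT (emeasurable_set1 +oo%E); rewrite setTI.
(* Up to the null event {tau = +oo}, an event of F_s alone is the increasing union of its traces on
   {tau <= n}. *)
have finite h : measurable_fun setT h -> (forall w, 0 <= h w) ->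
    (\int[P]_(w in B `&` [set w | (tau w <= n%:R%:E)%E]) (h w)%:E @[n --> \oo] -->
      \int[P]_(w in B) (h w)%:E)%E.
  move=> mh h0.
  have mh' V : measurable_fun V (EFin \o h).
    by apply: measurable_funTS; exact/measurable_EFinP.
  rewrite (@ge0_negligible_integral _ _ _ P B [set w | tau w = +oo%E])//; first last.
  - exact: avoids_cst usualF A_tau _ _.
  - by move=> w _; rewrite lee_fin.
  rewrite (_ : B `\` _ = \bigcup_n (B `&` [set w | (tau w <= n%:R%:E)%E])).
    apply: ge0_nondecreasing_set_cvg_integral => //.
    - move=> m n mn; apply/subsetPset => w /= [Bw tm]; split => //.
      by apply: le_trans tm _; rewrite lee_fin ler_nat.
    - by move=> n w _; rewrite lee_fin.
  apply/seteqP; split => w /=.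
    move=> [Bw]; case: rt_tau => _ /(_ w); case E : (tau w) => [x| |] //= x0 _.
    exists (Num.truncn x).+1 => //; split => //=.
    by rewrite E lee_fin ltW //; case/andP: (truncn_itv x0).
  by move=> [n _ [Bw tn]]; split => // toy; move: tn; rewrite /= toy.
rewrite -(cvg_lim _ (finite h1 mh1 h10))// -(cvg_lim _ (finite h2 mh2 h20))//.
congr (lim (_ @ \oo)); apply/funext => n; apply: rect => //.
exact: (filtration_sigma_infty s0).
Qed.

End determination.

(** * Equivalent changes of measure *)

Section densities.
Context d (T : measurableType d) (R : realType).
Implicit Types (P Q : probability T R) (S : set (set T)) (Z X : T -> R).
Local Open Scope ereal_scope.

(** Densities are positive only almost surely, whereas [take_out] asks for functions nonnegative
    everywhere; positive parts bridge the two. *)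
Lemma integral_max0 P X A : measurable A -> measurable_fun setT X ->
  {ae P, forall w, (0 <= X w)%R} ->
  \int[P]_(w in A) (X w)%:E = \int[P]_(w in A) (Num.max (X w) 0%R)%:E.
Proof.
move=> mA mX X0.
have mm : measurable_fun setT (fun w => Num.max (X w) 0%R).
  exact: measurable_maxr.
apply: ae_eq_integral => //.
- by apply: measurable_funTS; exact/measurable_EFinP.
- by apply: measurable_funTS; exact/measurable_EFinP.
- by apply: filterS X0 => w Xw _; rewrite (max_idPl Xw).
Qed.

Lemma positive_rv_ge0 P X : positive_rv P X -> {ae P, forall w, (0 <= X w)%R}.
Proof. by apply: filterS => w; exact: ltW. Qed.

(** The event {Z <= 0} of S has Q-mass at most 0, hence is Q-null, and by domination P-null. *)
Lemma density_positive P Q S Z : sub_sigma S -> P `<< Q -> is_density P Q S Z ->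
  positive_rv P Z.
Proof.
move=> sS PQ [mZ iZ ZE]; pose C := [set w | (0 <= 0 - Z w)%R].
have SC : S C.
  apply: measurable_wrt_ge => //.
  exact: (measurable_wrtB sS (@measurable_wrt_cst _ _ _ S 0%R sS) mZ).
have mC : measurable C by exact: sS.2.
have QC : Q C = 0.
  apply/eqP; rewrite eq_le measure_ge0 andbT ZE//.
  rewrite -(@integral0 _ _ _ P C); apply: le_integral => //.
  - exact: integrableS iZ.
  - exact: integrable0.
  - by move=> w /set_mem; rewrite /C/= sub0r lee_fin oppr_ge0.
have PC : P C = 0 by move/null_content_dominatesP : PQ; apply.
exists C; split => // w /= /negP; rewrite -leNgt => Zw.
by rewrite /C/= sub0r oppr_ge0.
Qed.

Lemma density_integral_max0 P Q S Z : sub_sigma S -> positive_rv P Z ->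
  is_density P Q S Z ->
  forall A, S A -> \int[Q]_(w in A) (cst 1%R w : R)%:E =
                   \int[P]_(w in A) (Num.max (Z w) 0%R)%:E.
Proof.
move=> sS Zpos [mZ _ ZE] A SA; have mA := sS.2 _ SA.
rewrite -integral_max0//; [|exact: measurable_wrt_fun mZ|exact: positive_rv_ge0].
by rewrite -ZE// -integral_cst1.
Qed.

End densities.

(** * Projections on F_oo that are known at time t *)

Section default_densities.
Context d (T : measurableType d) (R : realType).
Variables (P : probability T R) (Ft : R -> set (set T)) (tau : T -> \bar R).
Hypotheses (usualF : usual_conditions P Ft) (rt_tau : random_time tau)
  (A_tau : avoids_stopping_times P Ft tau).
Local Notation Gt := (progressive_enlargement Ft tau).
Local Notation Foo := (sigma_infty Ft).
Local Notation Goo := (sigma_infty Gt).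
Implicit Types (B C D : set T) (s t u r : R) (h X : T -> R).

Let filF : filtration Ft. Proof. by case: usualF. Qed.
Let subF t : 0 <= t -> sub_sigma (Ft t).
Proof. by move=> t0; apply: (filtration_sub filF). Qed.
Let subG t : 0 <= t -> sub_sigma (Gt t).
Proof. by move=> t0; apply: (enlargement_sub usualF rt_tau). Qed.
Let subFoo : sub_sigma Foo. Proof. exact: sigma_infty_sub filF. Qed.
Let subAt : sub_sigma (sigma_at Ft tau).
Proof. exact: sub_sigma_at usualF rt_tau A_tau. Qed.
Let mtaule t : measurable [set w | (tau w <= t%:E)%E].
Proof. exact: measurable_tau_le. Qed.
Let mindic C : measurable C -> measurable_fun setT (\1_C : T -> R).
Proof. by move=> mC; exact: measurable_indic. Qed.

(** The measure is free, since immersion serves under P for F_tau-measurable densities and under Q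
    for indicators of events of G_t. *)
Lemma immersed_adapted_cond_exp (P' : probability T R) t X : immersed P' Ft Gt ->
  0 <= t -> measurable_wrt (Gt t) X -> (forall w, 0 <= X w) ->
  (\int[P']_w (X w)%:E < +oo)%E ->
  exists b, [/\ measurable_wrt (Ft t) b, (forall w, 0 <= b w) &
    forall D, Foo D -> (\int[P']_(w in D) (X w)%:E = \int[P']_(w in D) (b w)%:E)%E].
Proof.
move=> imm t0 mX X0 iX.
have mX' : measurable_fun setT X by apply: measurable_wrt_fun mX; exact: subG.
have [b [mb b0 bE]] := cond_exp_exists (subF t0) mX' X0 iX.
exists b; split => //.
exact: (immersed_cond_exp filF subG imm t0).
Qed.

Lemma sigma_at_immersion_density h : immersed P Ft Gt ->
  measurable_wrt (sigma_at Ft tau) h -> (forall w, 0 <= h w) ->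
  (\int[P]_w (h w)%:E < +oo)%E -> immersion_density P Ft tau h.
Proof.
move=> imm mh h0 ih t C t0 GC Ct.
have mC : measurable C by exact: (subG t0).2.
have mh' : measurable_fun setT h by exact: measurable_wrt_fun mh.
have ch0 w : 0 <= \1_C w * h w by exact: mulr_ge0.
apply: immersed_adapted_cond_exp => //.
  move=> _ [V mV <-]; rewrite setTI.
  have -> : (fun w => \1_C w * h w) @^-1` V =
      (C `&` (h @^-1` V `&` [set w | (tau w <= t%:E)%E])) `|`
      (~` C `&` [set _ | V 0]).
    apply/seteqP; split => w /=; rewrite indicE.
      case: (boolP (w \in C)) => [/set_mem Cw|/negP nC].
        by rewrite mul1r => Vw; left; split => //; split => //; exact: Ct.
      by rewrite mul0r => Vw; right; split => // /mem_set.
    case=> [[Cw [Vw _]]|[nC V0]]; first by rewrite mem_set// mul1r.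
    by rewrite memNset// mul0r.
  apply: (sub_sigmaU (subG t0)).
    apply: (sub_sigmaI (subG t0) GC); apply: (sigma_at_trace_le usualF rt_tau) => //.
    by apply: mh; exists V => //; rewrite setTI.
  apply: (sub_sigmaI (subG t0) (sub_sigmaC (subG t0) GC)).
  have [V0|V0] := pselect (V 0).
    by have := sub_sigmaT (subG t0); congr Gt; apply/seteqP; split.
  by have := sub_sigma0 (subG t0); congr Gt; apply/seteqP; split.
apply: le_lt_trans ih; apply: integral_rv_le => //.
  by apply: measurable_funM => //; exact: mindic.
by move=> w; rewrite ler_piMl// indicE; case: (_ \in _).
Qed.

Lemma integral_trace h D C : measurable D -> measurable C ->
  measurable_fun setT h -> (forall w, 0 <= h w) ->
  (\int[P]_(w in D) (\1_C w * h w)%:E = \int[P]_(w in D `&` C) (h w)%:E)%E.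
Proof.
move=> mD mC mh h0; rewrite integral_indicM [RHS]integral_indicM.
by apply: eq_integral => w _; rewrite indicI mulrA.
Qed.

(** On {tau > t} the density h need not be G_t-measurable, but C is there the trace of an event of
    F_t, so only E[1_{tau > t} h | F_oo] has to be F_t-measurable. By the normalisation it is 1
    minus E[1_{tau <= t} h | F_oo]. *)
Lemma normalised_immersion_density h : immersed P Ft Gt ->
  measurable_wrt (sigma_at Ft tau) h -> (forall w, 0 <= h w) ->
  (\int[P]_w (h w)%:E < +oo)%E ->
  (forall D, Foo D -> \int[P]_(w in D) (h w)%:E = \int[P]_(w in D) (cst 1 w : R)%:E)%E ->
  forall t C, 0 <= t -> Gt t C ->
  exists b, [/\ measurable_wrt (Ft t) b, (forall w, 0 <= b w) &
    forall D, Foo D -> (\int[P]_(w in D) (\1_C w * h w)%:E =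
                        \int[P]_(w in D) (b w)%:E)%E].
Proof.
move=> imm mh h0 ih hE t C t0 GC.
have dens := sigma_at_immersion_density imm mh h0 ih.
have mC : measurable C by exact: (subG t0).2.
have mh' : measurable_fun setT h by exact: measurable_wrt_fun mh.
pose L := [set w | (tau w <= t%:E)%E]; pose U := [set w | (t%:E < tau w)%E].
have mL : measurable L by exact: mtaule.
have GL : Gt t L by exact: enlargement_le.
have ULC : U = ~` L.
  by apply/seteqP; split => w /=; rewrite /U/L/= ltNge => /negP.
have mU : measurable U by rewrite ULC; exact: measurableC.
have [C' FC' CC'] := enlargement_trace_gt usualF t0 GC.
have mC' : measurable C' by exact: (subF t0).2.
have [b1 [mb1 b10 b1E]] := dens t _ t0 (sub_sigmaI (subG t0) GC GL) (@subIsetr _ _ _).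
have [b0 [mb0 b00 b0E]] := dens t _ t0 GL (fun _ => id).
have mUh : measurable_fun setT (fun w => \1_U w * h w).
  by apply: measurable_funM => //; exact: mindic.
have Uh0 w : 0 <= \1_U w * h w by exact: mulr_ge0.
have iUh : (\int[P]_w (\1_U w * h w)%:E < +oo)%E.
  apply: le_lt_trans ih; apply: integral_rv_le => //.
  by move=> w; rewrite ler_piMl// indicE; case: (_ \in _).
have [c0 [mc0 c00 c0E]] := cond_exp_exists (subF t0) mUh Uh0 iUh.
have mb0' : measurable_fun setT b0 by apply: measurable_wrt_fun mb0; exact: subF.
have mb1' : measurable_fun setT b1 by apply: measurable_wrt_fun mb1; exact: subF.
have mc0' : measurable_fun setT c0 by apply: measurable_wrt_fun mc0; exact: subF.
have FtFoo : Ft t `<=` Foo by exact: filtration_sigma_infty.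
have split_h D (V : set T) : measurable D -> measurable V ->
    (\int[P]_(w in D) (\1_V w * h w)%:E = \int[P]_(w in D) (\1_(V `&` L) w * h w)%:E +
     \int[P]_(w in D) (\1_(V `&` U) w * h w)%:E)%E.
  move=> mD mV; rewrite !integral_trace//; [|exact: measurableI|exact: measurableI].
  rewrite -ge0_integral_setU//.
  - by rewrite -setIUr -setIUr ULC setUv setIT.
  - by apply: measurableI => //; exact: measurableI.
  - by apply: measurableI => //; exact: measurableI.
  - by apply: measurable_funTS; exact/measurable_EFinP.
  - by move=> w _; rewrite lee_fin.
  - apply/disj_setPS => w [[_ [_ Lw]] [_ [_]]].
    by rewrite ULC.
have addE D (X Y : T -> R) : measurable D -> measurable_fun setT X -> (forall w, 0 <= X w) ->
    measurable_fun setT Y -> (forall w, 0 <= Y w) ->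
    (\int[P]_(w in D) (X w + Y w)%:E = \int[P]_(w in D) (X w)%:E + \int[P]_(w in D) (Y w)%:E)%E.
  move=> mD mX X0 mY Y0; rewrite -ge0_integralD//.
  - by move=> w _; rewrite lee_fin.
  - by apply: measurable_funTS; exact/measurable_EFinP.
  - by move=> w _; rewrite lee_fin.
  - by apply: measurable_funTS; exact/measurable_EFinP.
have hsplit D : measurable D ->
    (\int[P]_(w in D) (h w)%:E = \int[P]_(w in D) (\1_L w * h w)%:E +
     \int[P]_(w in D) (\1_U w * h w)%:E)%E.
  move=> mD; rewrite -[L]setTI -[U]setTI -split_h//.
  by apply: eq_integral => w _; rewrite indicT mul1r.
(* On F_t, [b0 + c0] has the integrals of h, that is of 1. Keeping the sum instead of [1 - b0]
   leaves everything nonnegative. *)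
have bc D : Ft t D -> (\int[P]_(w in D) (b0 w + c0 w)%:E =
    \int[P]_(w in D) (cst 1 w : R)%:E)%E.
  move=> FD; have mD := (subF t0).2 _ FD.
  by rewrite addE// -b0E; [rewrite -c0E// -hsplit// hE//|]; exact: FtFoo.
have m1 : measurable_fun setT (cst 1 : T -> R) by exact: measurable_cst.
have p1 (w : T) : 0 <= cst 1 w :> R by rewrite /= ler01.
have c0Foo D : Foo D ->
    (\int[P]_(w in D) (\1_U w * h w)%:E = \int[P]_(w in D) (c0 w)%:E)%E.
  move=> FD; have mD := subFoo.2 _ FD.
  have iD w : 0 <= (\1_D w : R) <= 1.
    by rewrite indicE; case: (_ \in _); rewrite ?lexx ler01.
  have [a [ma a01 aE]] := cond_exp_exists01 P (subF t0) (mindic mD) iD.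
  have ma' : measurable_fun setT a by apply: measurable_wrt_fun ma; exact: subF.
  have a0 w : 0 <= a w by case/andP: (a01 w).
  have mbc : measurable_wrt (Ft t) (fun w => b0 w + c0 w).
    by apply: measurable_wrtD => //; exact: subF.
  have bc0 w : 0 <= b0 w + c0 w by rewrite addr_ge0.
  (* D is only in F_oo; its prediction a on F_t carries the identity for [b0 + c0] from events of
     F_t to D. *)
  have E1 : (\int[P]_(w in D) (b0 w + c0 w)%:E = \int[P]_(w in D) (h w)%:E)%E.
    rewrite integral_indicM; under eq_integral do rewrite mulrC.
    rewrite (take_out (subF t0) (mindic mD) _ ma' a0 aE mbc bc0)//.
    under eq_integral do rewrite mulrC.
    rewrite (take_out (subF t0) (measurable_wrt_fun (subF t0) mbc) bc0 m1 p1 bc ma a0).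
    under eq_integral do rewrite mulr1.
    rewrite -(aE _ (sub_sigmaT (subF t0))) hE// [RHS]integral_indicM.
    by apply: eq_integral => w _; rewrite mulr1.
  move: E1; rewrite addE// hsplit// b0E// => /esym; apply: fin_num_addeI.
  rewrite ge0_fin_numE; last by apply: integral_ge0 => w _; rewrite lee_fin.
  rewrite -b0E// integral_trace//; apply: integral_lty_subset => //.
  exact: measurableI.
exists (fun w => b1 w + \1_C' w * c0 w); split.
- apply: measurable_wrtD => //; first exact: subF.
  apply: measurable_wrtM => //; first exact: subF.
  by apply: measurable_wrt_indic => //; exact: subF.
- by move=> w; rewrite addr_ge0// mulr_ge0.
move=> D FD; have mD := subFoo.2 _ FD.
have FDC : Foo (D `&` C') by apply: (sub_sigmaI subFoo FD); exact: FtFoo.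
rewrite split_h// addE//; last 2 first.
- by apply: measurable_funM => //; exact: mindic.
- by move=> w; rewrite mulr_ge0.
rewrite b1E//; congr (_ + _)%E.
rewrite -/U in CC'; rewrite CC' integral_trace//; last exact: measurableI.
rewrite setIA -integral_trace//; last exact: measurableI.
by rewrite c0Foo// -integral_trace.
Qed.

End default_densities.

(** * The two implications *)

Section equivalent_change.
Context d (T : measurableType d) (R : realType).
Variables (P Q : probability T R) (Ft : R -> set (set T)) (tau : T -> \bar R).
Hypotheses (usualF : usual_conditions P Ft) (rt_tau : random_time tau)
  (A_tau : avoids_stopping_times P Ft tau)
  (immP : immersed P Ft (progressive_enlargement Ft tau)).
Local Notation Gt := (progressive_enlargement Ft tau).
Local Notation Foo := (sigma_infty Ft).
Local Notation Goo := (sigma_infty Gt).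
Implicit Types (B C D : set T) (s t u r : R) (h X : T -> R).

Let filF : filtration Ft. Proof. by case: usualF. Qed.
Let subF t : 0 <= t -> sub_sigma (Ft t).
Proof. by move=> t0; apply: (filtration_sub filF). Qed.
Let subG t : 0 <= t -> sub_sigma (Gt t).
Proof. by move=> t0; apply: (enlargement_sub usualF rt_tau). Qed.
Let subFoo : sub_sigma Foo. Proof. exact: sigma_infty_sub filF. Qed.
Let subGoo : sub_sigma Goo. Proof. exact: sub_sigma_infty_enlargement usualF rt_tau. Qed.
Let subAt : sub_sigma (sigma_at Ft tau).
Proof. exact: sub_sigma_at usualF rt_tau A_tau. Qed.
Let FooGoo : Foo `<=` Goo. Proof. exact: sigma_infty_enlargement usualF. Qed.
Let AtGoo : sigma_at Ft tau `<=` Goo.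
Proof. exact: sigma_at_sigma_infty usualF rt_tau A_tau. Qed.
Let m1 : measurable_fun setT (cst 1 : T -> R). Proof. exact: measurable_cst. Qed.
Let p1 (w : T) : 0 <= cst 1 w :> R. Proof. by rewrite /= ler01. Qed.
Let max0_ge0 (X : T -> R) w : 0 <= Num.max (X w) 0.
Proof. by rewrite le_max lexx orbT. Qed.

Lemma product_density_immersed (F H : T -> R) :
  positive_rv P F -> measurable_wrt Foo F ->
  positive_rv P H -> measurable_wrt (sigma_at Ft tau) H -> integrable_rv P H ->
  is_cond_exp P Foo H (cst 1) -> is_density P Q Goo (F \* H) ->
  immersed Q Ft Gt.
Proof.
move=> Fpos mF Hpos mH iH [_ _ HE] dens.
pose F' w := Num.max (F w) 0; pose H' w := Num.max (H w) 0.
have mF' : measurable_wrt Foo F' by exact: measurable_wrt_max0.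
have mH' : measurable_wrt (sigma_at Ft tau) H' by exact: measurable_wrt_max0.
have mFT := measurable_wrt_fun subFoo mF'.
have mHT := measurable_wrt_fun subAt mH'.
have F'0 w : 0 <= F' w by exact: max0_ge0.
have H'0 w : 0 <= H' w by exact: max0_ge0.
have mHT0 := measurable_wrt_fun subAt mH.
have H'E D : Foo D -> (\int[P]_(w in D) (H' w)%:E = \int[P]_(w in D) (cst 1 w : R)%:E)%E.
  move=> FD; have mD := subFoo.2 _ FD.
  by rewrite -integral_max0//; [rewrite HE|exact: positive_rv_ge0].
have iH' : (\int[P]_w (H' w)%:E < +oo)%E.
  by rewrite H'E ?integral_cst1 ?probability_setT ?ltry//; exact: sub_sigmaT subFoo.
have FHpos : positive_rv P (F \* H).
  apply: filterS2 Fpos Hpos => w Fw Hw /=; exact: mulr_gt0.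
have QE A : Goo A -> (\int[Q]_(w in A) (cst 1 w : R)%:E =
    \int[P]_(w in A) (F' w * H' w)%:E)%E.
  move=> GA; have mA := subGoo.2 _ GA; rewrite (density_integral_max0 subGoo FHpos dens)//.
  apply: ae_eq_integral => //.
  - apply: measurable_funTS; apply/measurable_EFinP; apply: measurable_maxr => //.
    by apply: measurable_wrt_fun subGoo _; case: dens.
  - by apply: measurable_funTS; apply/measurable_EFinP; exact: measurable_funM.
  - apply: filterS2 Fpos Hpos => w Fw Hw _ /=.
    by rewrite /F' /H' !(max_idPl _)// ltW// mulr_gt0.
have mFH : measurable_fun setT (fun w => F' w * H' w) by exact: measurable_funM.
have FH0 w : 0 <= F' w * H' w by exact: mulr_ge0.
(* b is E[H 1_C | F_oo] under P, and turns out to be Q[C | F_oo]: its F_t-measurability is immersion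
   under Q in dual form. *)
have transfer t C : 0 <= t -> Gt t C -> exists b, [/\ measurable_wrt (Ft t) b,
    (forall w, 0 <= b w) & forall Y, measurable_wrt Foo Y -> (forall w, 0 <= Y w) ->
    (\int[Q]_(w in C) (Y w)%:E = \int[Q]_w (b w * Y w)%:E)%E].
  move=> t0 GC.
  have [b [mb b0 bE]] := normalised_immersion_density usualF rt_tau A_tau immP
    mH' H'0 iH' H'E t0 GC.
  exists b; split => // Y mY Y0.
  have mbFoo : measurable_wrt Foo b.
    by apply: measurable_wrt_le mb; exact: filtration_sigma_infty.
  have GooC : Goo C by exact: enlargement_sigma_infty GC.
  have mC : measurable C by exact: subGoo.2.
  have mYG : measurable_wrt Goo Y by exact: measurable_wrt_le mY.
  have mFY : measurable_wrt Foo (fun w => F' w * Y w) by exact: measurable_wrtM.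
  have FY0 w : 0 <= F' w * Y w by exact: mulr_ge0.
  have mCH : measurable_fun setT (fun w => \1_C w * H' w).
    by apply: measurable_funM => //; exact: measurable_indic.
  have CH0 w : 0 <= \1_C w * H' w by exact: mulr_ge0.
  rewrite integral_indicM.
  transitivity (\int[P]_w (\1_C w * Y w * (F' w * H' w))%:E)%E.
    rewrite -(take_out subGoo m1 p1 mFH FH0 QE).
    - by apply: eq_integral => w _; rewrite mulr1.
    - by apply: measurable_wrtM => //; exact: measurable_wrt_indic.
    - by move=> w; exact: mulr_ge0.
  transitivity (\int[P]_w (F' w * Y w * (\1_C w * H' w))%:E)%E.
    by apply: eq_integral => w _; congr (_%:E); ring.
  rewrite (take_out subFoo mCH CH0 (measurable_wrt_fun subFoo mbFoo) b0 bE mFY FY0).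
  (* E[H | F_oo] = 1 lets H reappear beside F_oo-measurable factors, which restores the density of
     Q. *)
  transitivity (\int[P]_w (F' w * Y w * b w * H' w)%:E)%E.
    rewrite (take_out subFoo mHT H'0 m1 p1 H'E).
    - by apply: eq_integral => w _; rewrite mulr1.
    - exact: measurable_wrtM.
    - by move=> w; exact: mulr_ge0.
  transitivity (\int[P]_w (b w * Y w * (F' w * H' w))%:E)%E.
    by apply: eq_integral => w _; congr (_%:E); ring.
  rewrite -(take_out subGoo m1 p1 mFH FH0 QE).
  - by apply: eq_integral => w _; rewrite mulr1.
  - by apply: measurable_wrt_le FooGoo _; exact: measurable_wrtM.
  - by move=> w; exact: mulr_ge0.
move=> X [adX intX condX]; split => // [t t0|s t s0 st].
  by apply: measurable_wrt_le (adX t t0); exact: (filtration_enlargement usualF t0).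
have t0 := le_trans s0 st.
have [_ _ XE] := condX s t s0 st.
split; [|exact: intX|move=> B GB].
  by apply: measurable_wrt_le (adX s s0); exact: (filtration_enlargement usualF s0).
have [b [mb b0 bE]] := transfer s B s0 GB.
have mB : measurable B by exact: (subG s0).2.
(* Shifting both variables by m makes them nonnegative. *)
pose m w := `|X t w| + `|X s w|.
have mXt : measurable_wrt Foo (X t).
  by apply: measurable_wrt_le (adX t t0); exact: filtration_sigma_infty.
have mXs : measurable_wrt Foo (X s).
  by apply: measurable_wrt_le (adX s s0); exact: filtration_sigma_infty.
have mabs (Z : T -> R) : measurable_wrt Foo Z -> measurable_wrt Foo (fun w => `|Z w|).
  by move=> mZ; apply: (@measurable_wrt_comp _ _ _ Foo Z (fun x : R => `|x|)).
have mm : measurable_wrt Foo m.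
  by apply: measurable_wrtD => //; exact: mabs.
have im : Q.-integrable setT (EFin \o m).
  have -> : EFin \o m = ((abse \o (EFin \o X t)) \+ (abse \o (EFin \o X s)))%E.
    by apply/funext => w.
  by apply: integrableD => //; apply: integrable_abse; exact: intX.
have shift u C : 0 <= u -> measurable C ->
    (\int[Q]_(w in C) (X u w + m w)%:E =
     \int[Q]_(w in C) (X u w)%:E + \int[Q]_(w in C) (m w)%:E)%E.
  move=> u0 mC; rewrite -integralD//.
  - exact: integrableS (intX u u0).
  - exact: integrableS im.
have Xtm w : 0 <= X t w + m w.
  rewrite /m addrA addr_ge0// -lerBlDr sub0r; exact: lerNnormlW.
have Xsm w : 0 <= X s w + m w.
  rewrite /m addrCA addr_ge0// -lerBlDr sub0r; exact: lerNnormlW.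
have mXtm : measurable_wrt Foo (fun w => X t w + m w) by exact: measurable_wrtD.
have mXsm : measurable_wrt Foo (fun w => X s w + m w) by exact: measurable_wrtD.
have finm C : measurable C -> (\int[Q]_(w in C) (m w)%:E \is a fin_num)%E.
  by move=> mC; apply: integrable_fin_num => //; exact: integrableS im.
have H1 C : Ft s C -> (\int[Q]_(w in C) (X s w + m w)%:E =
    \int[Q]_(w in C) (X t w + m w)%:E)%E.
  by move=> FC; have mC := (subF s0).2 _ FC; rewrite !shift// XE.
have H2 : (\int[Q]_(w in B) (X s w + m w)%:E = \int[Q]_(w in B) (X t w + m w)%:E)%E.
  rewrite !bE//; apply: (take_out (subF s0)) => //; exact: measurable_wrt_fun subFoo _.
move: H2; rewrite !shift// => /(congr1 (fun x => x - \int[Q]_(w in B) (m w)%:E)%E).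
by rewrite !addeK// finm.
Qed.

Lemma immersed_product_density (e_oo E_oo : T -> R) :
  immersed Q Ft Gt -> equivalent_prob P Q ->
  is_density P Q Foo e_oo -> is_density P Q Goo E_oo ->
  exists F H : T -> R,
     [/\ positive_rv P F, measurable_wrt Foo F,
         integrable_rv P F & ('E_P[F] = 1)%E] /\
     [/\ positive_rv P H, measurable_wrt (sigma_at Ft tau) H,
         integrable_rv P H & is_cond_exp P Foo H (cst 1)] /\
     integrable_rv P (F \* H) /\ is_density P Q Goo (F \* H).
Proof.
move=> immQ [PQ QP] de dE.
have epos := density_positive subFoo PQ de.
have Epos := density_positive subGoo PQ dE.
have eE := density_integral_max0 subFoo epos de.
have EE := density_integral_max0 subGoo Epos dE.
have [me0 _ _] := de; have [mE0 _ _] := dE.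
set e' := fun w => Num.max (e_oo w) 0 in eE.
set E' := fun w => Num.max (E_oo w) 0 in EE.
have me : measurable_wrt Foo e' by exact: measurable_wrt_max0.
have mE : measurable_wrt Goo E' by exact: measurable_wrt_max0.
have meT := measurable_wrt_fun subFoo me; have mET := measurable_wrt_fun subGoo mE.
have e0 w : 0 <= e' w by exact: max0_ge0.
have E0 w : 0 <= E' w by exact: max0_ge0.
have e'pos : positive_rv P e'.
  by apply: filterS epos => w ew; rewrite /e' lt_max ew.
have QT : (\int[Q]_w (cst 1 w : R)%:E = 1)%E.
  by rewrite integral_cst1// probability_setT.
have ie : (\int[P]_w (e' w)%:E = 1)%E by rewrite -eE//; exact: sub_sigmaT subFoo.
have iE : (\int[P]_w (E' w)%:E = 1)%E by rewrite -EE//; exact: sub_sigmaT subGoo.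
(* The inverse is 0 where e' vanishes; this happens only on a null set, so multiplying by [v * e']
   changes no integral. *)
pose v w := (e' w)^-1.
have mv : measurable_wrt Foo v by exact: measurable_wrtV.
have v0 w : 0 <= v w by rewrite invr_ge0.
have mvT := measurable_wrt_fun subFoo mv.
have ev X : measurable_fun setT X -> (forall w, 0 <= X w) -> forall D, measurable D ->
    (\int[P]_(w in D) (X w)%:E = \int[P]_(w in D) (X w * v w * e' w)%:E)%E.
  move=> mX X0 D mD; apply: ge0_ae_eq_integral => //.
  - by apply: measurable_funTS; exact/measurable_EFinP.
  - apply: measurable_funTS; apply/measurable_EFinP.
    by apply: measurable_funM => //; exact: measurable_funM.
  - by move=> w _; rewrite lee_fin.
  - by move=> w _; rewrite lee_fin !mulr_ge0.
  - by apply: filterS e'pos => w ew _; rewrite /v mulfVK// gt_eqF.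
pose h w := v w * E' w.
have mvG : measurable_wrt Goo v by exact: measurable_wrt_le mv.
have mh : measurable_wrt Goo h by exact: measurable_wrtM.
have mhT := measurable_wrt_fun subGoo mh.
have h0 w : 0 <= h w by exact: mulr_ge0.
have Ee A : Foo A -> (\int[P]_(w in A) (E' w)%:E = \int[P]_(w in A) (e' w)%:E)%E.
  by move=> FA; rewrite -EE -?eE//; exact: FooGoo.
have hE A : Foo A -> (\int[P]_(w in A) (h w)%:E = \int[P]_(w in A) (cst 1 w : R)%:E)%E.
  move=> FA; rewrite (take_out_set subFoo FA mET E0 meT e0 Ee mv v0).
  rewrite (ev (cst 1))//; last exact: subFoo.2.
  by apply: eq_integral => w _; rewrite /= mul1r.
have ih : (\int[P]_w (h w)%:E < +oo)%E.
  by rewrite hE ?integral_cst1 ?probability_setT ?ltry//; exact: sub_sigmaT subFoo.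
(* The integral of 1_C h over D under P is that of 1_C / e_oo over D under Q. Immersion under Q
   replaces 1_C by an F_t-measurable b = Q[C | F_oo], and returning to P on F_oo cancels e_oo. *)
have dens_h : immersion_density P Ft tau h.
  move=> t C t0 GC _.
  have GooC : Goo C by exact: enlargement_sigma_infty GC.
  have mC : measurable C by exact: subGoo.2.
  have mi : measurable_fun setT (\1_C : T -> R) by exact: measurable_indic.
  have [||b [mb b0 bE]] := immersed_adapted_cond_exp usualF rt_tau immQ t0
    (@measurable_wrt_indic _ T R _ _ (subG t0) GC) _ _ => //.
    by rewrite integral_indic// setIT (le_lt_trans (probability_le1 _ _))// ltry.
  exists b; split => // D FD; have mD := subFoo.2 _ FD.
  have mbFoo : measurable_wrt Foo b.
    by apply: measurable_wrt_le mb; exact: filtration_sigma_infty.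
  have mbT := measurable_wrt_fun subFoo mbFoo.
  have mDv : measurable_wrt Foo (fun w => \1_D w * v w).
    by apply: measurable_wrtM => //; exact: measurable_wrt_indic.
  have Dv0 w : 0 <= \1_D w * v w by exact: mulr_ge0.
  rewrite integral_indicM.
  transitivity (\int[P]_w (\1_D w * v w * \1_C w * E' w)%:E)%E.
    by apply: eq_integral => w _; congr (_%:E); rewrite /h; ring.
  rewrite -(take_out subGoo m1 p1 mET E0 EE); last 2 first.
  - apply: measurable_wrtM => //; last exact: measurable_wrt_indic.
    exact: measurable_wrt_le mDv.
  - by move=> w; exact: mulr_ge0.
  under eq_integral do rewrite mulr1.
  rewrite (take_out subFoo mi _ mbT b0 bE mDv Dv0)//.
  transitivity (\int[Q]_w (\1_D w * v w * b w * cst 1 w)%:E)%E.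
    by apply: eq_integral => w _; rewrite mulr1.
  rewrite (take_out subFoo m1 p1 meT e0 eE); last 2 first.
  - exact: measurable_wrtM.
  - by move=> w; exact: mulr_ge0.
  rewrite (ev b)// [RHS]integral_indicM.
  by apply: eq_integral => w _; congr (_%:E); ring.
(* k is the H of the conclusion; a priori it agrees with h on F_tau only. *)
have [k [mk k0 kE]] := cond_exp_exists subAt mhT h0 ih.
have mkT := measurable_wrt_fun subAt mk.
have ik : (\int[P]_w (k w)%:E < +oo)%E by rewrite -kE//; exact: sub_sigmaT subAt.
have dens_k := sigma_at_immersion_density usualF rt_tau A_tau immP mk k0 ik.
have hk := immersion_density_determined usualF rt_tau A_tau immP mhT h0 ih mkT k0 ik
  dens_h dens_k kE.
have meG : measurable_wrt Goo e' by exact: measurable_wrt_le me.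
have mkG : measurable_wrt Goo k by exact: measurable_wrt_le mk.
have ek A : Goo A -> (\int[Q]_(w in A) (cst 1 w : R)%:E =
    \int[P]_(w in A) (e' w * k w)%:E)%E.
  move=> GA; rewrite -(take_out_set subGoo GA mhT h0 mkT k0 hk meG e0) EE//.
  rewrite (ev E')//; last exact: subGoo.2.
  by apply: eq_integral => w _; congr (_%:E); rewrite /h; ring.
have mek : measurable_wrt Goo (e' \* k) by exact: measurable_wrtM.
have iek : integrable_rv P (e' \* k).
  apply: integrable_rv_ge0 => [|w|].
  - exact: measurable_wrt_fun mek.
  - exact: mulr_ge0.
  - by rewrite -ek ?QT ?ltry//; exact: sub_sigmaT subGoo.
have dek : is_density P Q Goo (e' \* k).
  split => // A GA; rewrite -ek// integral_cst1//; exact: subGoo.2.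
exists e', k; split; [split|split; [split|by split]] => //.
- by apply: integrable_rv_ge0 => //; rewrite ie ltry.
- by rewrite unlock.
(* The product of e' and k is a density of Q, hence positive almost surely, which excludes zeros of
   the nonnegative k. *)
- apply: filterS (density_positive subGoo PQ dek) => w /= ekw.
  by rewrite lt0r k0 andbT; apply/eqP => kw; move: ekw; rewrite kw mulr0 ltxx.
- exact: integrable_rv_ge0.
- split; [exact: measurable_wrt_cst| |].
    by apply: integrable_rv_ge0 => //; rewrite integral_cst1 ?probability_setT ?ltry.
  by move=> A FA; rewrite -hE// hk//; exact: FooGoo.
Qed.

End equivalent_change.

Theorem theorem6p2 (d : measure_display) (T : measurableType d) (R : realType)
    (P Q : probability T R) (Ft : R -> set (set T)) (tau : T -> \bar R)
    (e E : R -> T -> R) (e_oo E_oo : T -> R)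
    (usualF : usual_conditions P Ft)
    (rt_tau : random_time tau)
    (A_tau : avoids_stopping_times P Ft tau)
    (immP : immersed P Ft (progressive_enlargement Ft tau))
    (eqPQ : equivalent_prob P Q)
    (dens_e : cadlag_density_process P Q Ft e)
    (dens_E : cadlag_density_process P Q (progressive_enlargement Ft tau) E)
    (dens_e_oo : is_density P Q (sigma_infty Ft) e_oo)
    (dens_E_oo :
      is_density P Q (sigma_infty (progressive_enlargement Ft tau)) E_oo) :
  (forall F H : T -> R,
     positive_rv P F -> measurable_wrt (sigma_infty Ft) F ->
     integrable_rv P F -> ('E_P[F] = 1)%E ->
     positive_rv P H -> measurable_wrt (sigma_at Ft tau) H ->
     integrable_rv P H -> is_cond_exp P (sigma_infty Ft) H (cst 1) ->
     integrable_rv P (F \* H) ->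
     is_density P Q (sigma_infty (progressive_enlargement Ft tau)) (F \* H) ->
     immersed Q Ft (progressive_enlargement Ft tau))
  /\
  (immersed Q Ft (progressive_enlargement Ft tau) ->
   ('E_P[(fun w => e_oo w ^+ 2 / E_oo w)%R] < +oo)%E ->
   exists F H : T -> R,
     [/\ positive_rv P F, measurable_wrt (sigma_infty Ft) F,
         integrable_rv P F & ('E_P[F] = 1)%E] /\
     [/\ positive_rv P H, measurable_wrt (sigma_at Ft tau) H,
         integrable_rv P H & is_cond_exp P (sigma_infty Ft) H (cst 1)] /\
     integrable_rv P (F \* H) /\
     is_density P Q (sigma_infty (progressive_enlargement Ft tau)) (F \* H)).
Proof.
split=> [F H Fpos mF _ _ Hpos mH iH HE _|immQ _].
  exact: (product_density_immersed usualF rt_tau A_tau immP).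
exact: (immersed_product_density usualF rt_tau A_tau immP immQ eqPQ dens_e_oo dens_E_oo).
Qed.
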